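(* Let $k>0$, $R>0$, $\omega\in S^1$, and let $n\ge1$ be an integer. Let $\gamma_0$ be the unique positive solution of the equation $\log t+t/e=0$ and let $0<\gamma<\gamma_0$. Let $\{s(N)\}_{N=1,2,\ldots}$ be an arbitrary sequence of positive numbers satisfying, as $N\to\infty$, $$(R\,s(N))^n=\frac{\gamma}{e}N+O(1).$$ Then, as $N\to\infty$, $$\sup_{|x|\le2R}\bigl|Hg_N(\cdot;s(N),k,\omega)(x)-E_{1/n}(x;s(N),k,\omega)\bigr|+\sup_{|x|\le2R}\bigl|\nabla\{Hg_N(\cdot;s(N),k,\omega)(x)-E_{1/n}(x;s(N),k,\omega)\}\bigr|$$ $$=O\left(N^{3/2}e^{N\left(\frac{\gamma}{e}+\log\gamma\right)}\right)=O(N^{-\infty}).$$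
   Context: $O(N^{-\infty})$ means $O(N^{-m})$ for every $m\ge 1$. For $g\in L^2(S^1)$, $Hg(x)=\int_{S^1}e^{ikx\cdot\varphi}g(\varphi)\,d\sigma(\varphi)$, $x\in\mathbf{R}^2$ (Herglotz wave function). A point $\vartheta=(\vartheta_1,\vartheta_2)\in S^1$ is identified with the complex number $\vartheta_1+i\vartheta_2$, and $$g_N(\varphi;s,k,\omega)=\frac1{2\pi}\sum_{m=0}^{nN}\frac{\Gamma(m+1)}{\Gamma\left(\frac mn+1\right)}\left(\frac{s\overline\omega\varphi}{ik}\right)^m,\quad\varphi\in S^1,\ s>0.$$ Let $J_m$ be the Bessel function of order $m$. For $0<\alpha\le1$ and $\tau>0$ define $$E^k_\alpha(x;\tau)=\sum_{m=0}^\infty\frac{\{\tau(x_1+ix_2)\}^m}{\Gamma(\alpha m+1)}\left(\frac{2}{k|x|}\right)^m m!\,J_m(k|x|),\quad x=(x_1,x_2)\in\mathbf{R}^2,$$ where $(2/t)^m m!J_m(t)$ is understood as $1$ at $t=0$. For $\omega=(\omega_1,\omega_2)\in S^1$ set $\omega^\perp=(-\omega_2,\omega_1)$ and $$E_{1/n}(x;s,k,\omega)=E^k_{1/n}\left((x\cdot\omega,\,x\cdot\omega^\perp);\frac s2\right),\quad s>0.$$ *)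

(* Defs.v *)
From Stdlib Require Import Reals Factorial Lra.
From Coquelicot Require Import Coquelicot.
Open Scope R_scope.

(* Points of the plane are elements of [C = R * R]; [Cmod] is then the Euclidean
   norm, and S^1 is the set of [w : C] with [Cmod w = 1]. *)

Definition dot (x y : C) : R := fst x * fst y + snd x * snd y.

Definition perp (w : C) : C := (- snd w, fst w).

(* For continuous [f] this is the integral over S^1 against arc length. *)
Definition circle_int (f : C -> C) : C :=
  @RInt C_R_CompleteNormedModule
    (fun theta => f (cos theta, sin theta)) 0 (2 * PI).

(* e^{it} for real [t]. *)
Definition cis (t : R) : C := (cos t, sin t).

(* The densities used here are continuous on S^1, so the Riemann integral in
   [circle_int] agrees with the Lebesgue integral defining Hg for g in L^2. *)
Definition Herglotz (k : R) (g : C -> C) (x : C) : C :=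
  circle_int (fun phi => cis (k * dot x phi) * g phi)%C.

(* Euler's integral, converging for [z > 0]. *)
Definition Gamma (z : R) : R :=
  RInt_gen (fun t => Rpower t (z - 1) * exp (- t))
    (at_right 0) (Rbar_locally p_infty).

Definition BesselJ (m : nat) (t : R) : R :=
  Series (fun j => (-1) ^ j / (INR (fact j) * INR (fact (m + j)))
                   * (t / 2) ^ (2 * j + m)).

(* (2/t)^m m! J_m(t), understood as 1 at t = 0. *)
Definition BesselJ_normalized (m : nat) (t : R) : R :=
  if Req_EM_T t 0 then 1
  else (2 / t) ^ m * INR (fact m) * BesselJ m t.

Definition CSeries (a : nat -> C) : C :=
  (Series (fun m => Re (a m)), Series (fun m => Im (a m))).

Definition g_N (n N : nat) (s k : R) (omega phi : C) : C :=
  (RtoC (/ (2 * PI)) *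
   @sum_n C_AbelianMonoid
     (fun m => RtoC (Gamma (INR m + 1) / Gamma (INR m / INR n + 1)) *
               (RtoC s * Cconj omega * phi / (Ci * RtoC k)) ^ m)
     (n * N))%C.

Definition E_alpha (k alpha : R) (x : C) (tau : R) : C :=
  CSeries (fun m =>
    ((RtoC tau * (RtoC (fst x) + Ci * RtoC (snd x))) ^ m
     / RtoC (Gamma (alpha * INR m + 1))
     * RtoC (BesselJ_normalized m (k * Cmod x)))%C).

Definition E_inv (n : nat) (x : C) (s k : R) (omega : C) : C :=
  E_alpha k (/ INR n) (dot x omega, dot x (perp omega)) (s / 2).

Definition partial1 (f : C -> C) (x : C) : C :=
  (Derive (fun t => Re (f (t, snd x))) (fst x),
   Derive (fun t => Im (f (t, snd x))) (fst x)).

Definition partial2 (f : C -> C) (x : C) : C :=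
  (Derive (fun t => Re (f (fst x, t))) (snd x),
   Derive (fun t => Im (f (fst x, t))) (snd x)).

(* Euclidean norm in C^2 of the real gradient of a complex-valued function. *)
Definition grad_norm (f : C -> C) (x : C) : R :=
  sqrt (Cmod (partial1 f x) ^ 2 + Cmod (partial2 f x) ^ 2).

Definition sup_disk (r : R) (u : C -> R) : Rbar :=
  Lub_Rbar (fun y => exists x : C, Cmod x <= r /\ y = u x).

(* [u N = O(b N)] as N tends to infinity. The left side takes values in [Rbar]
   because suprema do; the bound in particular asserts that they are finite. *)
Definition is_bigO (u : nat -> Rbar) (b : nat -> R) : Prop :=
  exists c : R,
    eventually (fun N => Rbar_le (Rbar_abs (u N)) (Finite (c * Rabs (b N)))).

Definition is_bigO_infty (u : nat -> Rbar) : Prop :=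
  forall m : nat, (1 <= m)%nat -> is_bigO u (fun N => / INR N ^ m).

Definition gamma0_eq (t : R) : Prop := 0 < t /\ ln t + t / exp 1 = 0.

Lemma gamma0_exists_unique : exists! t : R, gamma0_eq t.
Proof.
assert (Hc : continuity (fun u => u + exp (u - 1))).
{ intros u; apply derivable_continuous_pt; reg. }
destruct (IVT (fun u => u + exp (u - 1)) (-1) 1 Hc) as [u [_ Hu]].
- lra.
- assert (H := exp_increasing (-1 - 1) 0 ltac:(lra)).
  rewrite exp_0 in H; lra.
- assert (H := exp_pos (1 - 1)); lra.
- assert (Hdiv : forall v, exp (v - 1) = exp v / exp 1).
  { intros v; unfold Rminus, Rdiv; rewrite exp_plus, exp_Ropp; reflexivity. }
  exists (exp u); split.
  + split; [apply exp_pos|].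
    rewrite ln_exp, <- Hdiv; exact Hu.
  + intros t [Ht Et].
    rewrite <- (exp_ln t Ht) in Et at 2.
    rewrite <- Hdiv in Et.
    rewrite <- (exp_ln t Ht); f_equal.
    destruct (Rtotal_order u (ln t)) as [L|[L|L]]; [|exact L|].
    * assert (H := exp_increasing (u - 1) (ln t - 1) ltac:(lra)); lra.
    * assert (H := exp_increasing (ln t - 1) (u - 1) ltac:(lra)); lra.
Qed.

(* Main.v *)
Require Import Defs.
From Stdlib Require Import Reals Factorial Lra Lia.
From Coquelicot Require Import Coquelicot.
Open Scope R_scope.

(** The density [g_N] is a trigonometric polynomial, so its Herglotz wave is a
    finite combination of the integrals of [e^{ik x.phi} phi^m] over the circle.
    By the Jacobi-Anger expansion ([Jacobi_Anger]) such an integral is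
    [2 pi i^m J_m(k|x|) (x/|x|)^m], and the coefficients of [g_N] are chosen so
    that the wave becomes exactly the partial sum, over [m <= nN], of the series
    that defines [E_{1/n}] ([Herglotz_g_N], [E_inv_eq_series]). The error is
    therefore minus the remainder of that series.

    For [|x| <= X] the [m]-th term is at most a constant times
    [(sX/2)^m / Gamma(m/n + 1)], and it is Lipschitz in [x] with constant at most
    [m + 1] times that, up to another constant ([wave_term_bound],
    [wave_term_lipschitz]). Put [a = (sX/2)^n]. Grouping the indices in blocks of
    length [n], the terms of block [M] are controlled by [a^M / M!] up to a factor
    polynomial in [M] and [a] ([inv_Gamma_bound]). Since [a] is
    [gamma N / e + O(1)] with [gamma < 1 < e/2], the quotient [a^M / M!] is at
    least halved at each step from [M = N] on ([pow_over_fact_decay]), so that the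
    whole remainder is [O(N^2 a^N / N!)] ([majorant_tail_bound]). From [N! >= (N/e)^N]
    one gets [a^N / N! = O(gamma^N)] ([leading_term_bound]), and
    [N^2 gamma^N = O(N^{3/2} e^{gamma N / e} gamma^N)] because
    [N^{1/2} = O(e^{gamma N / e})].

    The gradient is controlled by the Lipschitz constant of the error, since
    partial derivatives are limits of difference quotients ([grad_norm_le]).
    Difference quotients at the points of the disk of radius [2R] involve nearby
    points outside it, so the estimates are made with [X = 2R (1 + 1/N)]; this
    changes [a] by a bounded amount only ([perturbed_power_bound]).

    Finally [ln t + t/e] is increasing, so [gamma/e + ln gamma] is negative for
    [gamma < gamma0] and the bound decays exponentially ([gamma_bounds],
    [exp_decay_beats_power]). *)

(** * Complex numbers and finite sums *)

(* Views an equation in one of the structures carried by [C] as one in [C], where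
   [ring] applies. *)
Ltac C_eq := match goal with |- @eq _ ?a ?b => change (@eq C a b) end.

Lemma INR_fact_pos m : 0 < INR (fact m).
Proof. apply lt_0_INR, lt_O_fact. Qed.

Lemma C_ext (z w : C) : Re z = Re w -> Im z = Im w -> z = w.
Proof. destruct z, w; simpl; intros -> ->; reflexivity. Qed.

Lemma RtoC_neq_0 (a : R) : a <> 0 -> RtoC a <> 0%C.
Proof. intros H E; apply H; exact (f_equal Re E). Qed.

Lemma Re_sum_n (f : nat -> C) P : Re (sum_n f P) = sum_n (fun p => Re (f p)) P.
Proof.
induction P as [|P IH]; [rewrite !sum_O; reflexivity|].
rewrite !sum_Sn, <- IH; reflexivity.
Qed.

Lemma Im_sum_n (f : nat -> C) P : Im (sum_n f P) = sum_n (fun p => Im (f p)) P.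
Proof.
induction P as [|P IH]; [rewrite !sum_O; reflexivity|].
rewrite !sum_Sn, <- IH; reflexivity.
Qed.

Lemma Cmult_sum_n (c : C) (f : nat -> C) P :
  (c * sum_n f P)%C = sum_n (fun p => c * f p)%C P.
Proof.
induction P as [|P IH]; [rewrite !sum_O; reflexivity|].
rewrite !sum_Sn, <- IH; unfold plus; simpl; ring.
Qed.

Lemma sum_n_shift {G : AbelianMonoid} (f : nat -> G) P :
  sum_n f (S P) = plus (f O) (sum_n (fun p => f (S p)) P).
Proof.
induction P as [|P IH]; [rewrite sum_Sn, !sum_O; reflexivity|].
rewrite sum_Sn, IH, sum_Sn, plus_assoc; reflexivity.
Qed.

Lemma sum_n_eq_zero {G : AbelianMonoid} (f : nat -> G) P :
  (forall p, (p <= P)%nat -> f p = zero) -> sum_n f P = zero.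
Proof.
induction P as [|P IH]; intros H; [rewrite sum_O; auto|].
rewrite sum_Sn, IH, H, plus_zero_l; auto.
Qed.

Lemma sum_n_single {G : AbelianMonoid} (f : nat -> G) j P : (j <= P)%nat ->
  (forall p, (p <= P)%nat -> p <> j -> f p = zero) -> sum_n f P = f j.
Proof.
induction P as [|P IH]; intros Hj H.
- rewrite sum_O; replace j with O by lia; reflexivity.
- rewrite sum_Sn; destruct (PeanoNat.Nat.eq_dec j (S P)) as [->|Hn].
  + rewrite sum_n_eq_zero, plus_zero_l; [reflexivity|intros; apply H; lia].
  + rewrite IH, (H (S P)), plus_zero_r; [reflexivity|lia|lia|lia|intros; apply H; lia].
Qed.

(** The degree [p] part of the exponential contributes to the [m]-th Fourier
    coefficient only for [p = 2j + m]; this removes the other degrees. *)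
Lemma sum_n_supported {G : AbelianMonoid} (f : nat -> G) m J :
  (forall p, (forall j, p <> 2 * j + m)%nat -> f p = zero) ->
  sum_n f (2 * J + m) = sum_n (fun j => f (2 * j + m)%nat) J.
Proof.
intros H; induction J as [|J IH].
- rewrite sum_O; apply sum_n_single; [lia|intros p ? ?; apply H; intros j; lia].
- replace (2 * S J + m)%nat with (S (S (2 * J + m))) by lia.
  rewrite !sum_Sn, IH, (H (S (2 * J + m))), plus_zero_r by (intros j; lia).
  f_equal; f_equal; lia.
Qed.

(** The divided power [z^p / p!]: with this normalization the binomial theorem
    has no coefficients, and [sum_n (divpow z)] is the exponential series. *)
Definition divpow (z : C) (p : nat) : C := (RtoC (/ INR (fact p)) * z ^ p)%C.

Lemma mult_divpow z p : (z * divpow z p = RtoC (INR (S p)) * divpow z (S p))%C.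
Proof.
unfold divpow; rewrite fact_simpl, mult_INR, Rinv_mult, RtoC_mult, Cpow_S.
rewrite (RtoC_inv (INR (S p))) by (apply not_0_INR; lia).
field; apply RtoC_neq_0, not_0_INR; lia.
Qed.

(** The induction multiplies by [S p], split as [(S p - q) + q] in the term of
    index [q]: the first part comes from multiplication by [a], the second from
    multiplication by [b]. *)
Lemma divpow_plus (a b : C) p :
  divpow (a + b) p = sum_n (fun q => divpow a (p - q) * divpow b q)%C p.
Proof.
induction p as [|p IH].
{ rewrite sum_O; unfold divpow; simpl; rewrite Rinv_1; ring. }
set (G := fun q => (divpow a (S p - q) * divpow b q)%C).
apply (f_equal (Cmult (a + b)%C)) in IH; rewrite mult_divpow in IH.
assert (Hp : RtoC (INR (S p)) <> 0%C) by (apply RtoC_neq_0, not_0_INR; lia).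
assert (E : (RtoC (INR (S p)) * divpow (a + b) (S p) = RtoC (INR (S p)) * sum_n G (S p))%C).
{ rewrite IH, !Cmult_sum_n.
  transitivity (plus (sum_n (fun q => RtoC (INR (S p - q)) * G q)%C (S p))
                     (sum_n (fun q => RtoC (INR q) * G q)%C (S p))).
  - rewrite sum_Sn, (sum_n_shift (fun q => RtoC (INR q) * G q)%C).
    replace (S p - S p)%nat with O by lia.
    replace (RtoC (INR 0) * G (S p))%C with (zero : C) by (unfold zero; simpl; ring).
    replace (RtoC (INR 0) * G O)%C with (zero : C) by (unfold zero; simpl; ring).
    rewrite plus_zero_l, plus_zero_r, <- sum_n_plus.
    apply sum_n_ext_loc; intros q Hq; unfold G.
    replace (S p - q)%nat with (S (p - q)) by lia.
    replace (S p - S q)%nat with (p - q)%nat by lia.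
    assert (Ea := mult_divpow a (p - q)); assert (Eb := mult_divpow b q).
    C_eq; transitivity ((a * divpow a (p - q)) * divpow b q
                  + divpow a (p - q) * (b * divpow b q))%C; [ring|].
    rewrite Ea, Eb; unfold plus; cbn -[INR divpow]; ring.
  - rewrite <- sum_n_plus; apply sum_n_ext_loc; intros q Hq.
    rewrite minus_INR, RtoC_minus by lia; C_eq; unfold plus; cbn -[INR]; ring. }
apply (f_equal (Cmult (/ RtoC (INR (S p)))%C)) in E.
rewrite !Cmult_assoc, Cinv_l, !Cmult_1_l in E by exact Hp; exact E.
Qed.

(** * Euler's integral for arguments at least 1 *)

(** The two ends of Euler's integral converge because the integrand is positive
    and its integrals over compact intervals are bounded. *)
Lemma monotone_bounded_limit (G : R -> R) (a B : R) :
  (forall x y, a <= x <= y -> G x <= G y) ->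
  (forall x, a <= x -> G x <= B) ->
  exists l, filterlim G (Rbar_locally p_infty) (locally l).
Proof.
intros Hmono HB.
destruct (completeness (fun y => exists x, a <= x /\ y = G x)) as [l [Hub Hlub]].
- exists B; intros y [x [Hx ->]]; auto.
- exists (G a); exists a; split; [lra|reflexivity].
- exists l; apply filterlim_locally; intros eps.
  destruct (Classical_Prop.classic (exists x, a <= x /\ l - eps < G x)) as [[x [Hx Hlt]]|Hno].
  + exists x; intros y Hy.
    assert (G y <= l) by (apply Hub; exists y; split; [lra|reflexivity]).
    assert (G x <= G y) by (apply Hmono; lra).
    apply Rabs_def1; unfold minus, plus, opp; simpl; destruct eps; simpl in *; lra.
  + exfalso.
    assert (l <= l - eps); [|destruct eps; simpl in *; lra].
    apply Hlub; intros y [x [Hx ->]].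
    destruct (Rle_lt_dec (G x) (l - eps)) as [H|H]; [exact H|].
    exfalso; apply Hno; exists x; auto.
Qed.

(** For [t <= 0] the totalized [Rpower] is 1, so that the integrand jumps at 0
    when [z > 1]; every integral over a compact interval below therefore has
    positive end points. *)
Definition Gamma_integrand (z t : R) : R := Rpower t (z - 1) * exp (- t).

Lemma Gamma_integrand_pos z t : 0 < Gamma_integrand z t.
Proof. apply Rmult_lt_0_compat; apply exp_pos. Qed.

Lemma continuous_Gamma_integrand z t : 0 < t -> continuous (Gamma_integrand z) t.
Proof.
intros Ht; apply (ex_derive_continuous (Gamma_integrand z)).
unfold Gamma_integrand, Rpower; auto_derive; lra.
Qed.

Lemma ex_RInt_Gamma_integrand z a b :
  0 < a -> 0 < b -> ex_RInt (Gamma_integrand z) a b.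
Proof.
intros Ha Hb; apply (ex_RInt_continuous (V := R_CompleteNormedModule)).
intros t [Ht _]; apply continuous_Gamma_integrand.
apply Rlt_le_trans with (2 := Ht); apply Rmin_glb_lt; assumption.
Qed.

Lemma RInt_Gamma_integrand_mono z a a' b b' :
  0 < a' <= a -> a <= b <= b' ->
  RInt (Gamma_integrand z) a b <= RInt (Gamma_integrand z) a' b'.
Proof.
intros Ha Hb.
assert (H0 : forall u v, 0 < u <= v -> 0 <= RInt (Gamma_integrand z) u v).
{ intros u v Huv; apply RInt_ge_0; [lra| |].
  - apply ex_RInt_Gamma_integrand; lra.
  - intros t _; apply Rlt_le, Gamma_integrand_pos. }
rewrite <- (RInt_Chasles (Gamma_integrand z) a' a b'),
        <- (RInt_Chasles (Gamma_integrand z) a b b');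
  try (apply ex_RInt_Gamma_integrand; lra).
assert (h1 := H0 a' a ltac:(lra)); assert (h2 := H0 b b' ltac:(lra)).
unfold plus; simpl; lra.
Qed.

Lemma Rpower_le_1_left t y : 0 < t <= 1 -> 0 <= y -> Rpower t y <= 1.
Proof.
intros Ht Hy; unfold Rpower; rewrite <- exp_0.
destruct (Req_dec t 1) as [->|Hn]; [rewrite ln_1, Rmult_0_r; lra|].
assert (ln t < 0) by (rewrite <- ln_1; apply ln_increasing; lra).
destruct (Rle_lt_or_eq_dec (y * ln t) 0) as [Hlt|Heq]; [nra| |rewrite Heq; lra].
apply Rlt_le, exp_increasing; exact Hlt.
Qed.

Lemma Gamma_integrand_le_right z t : 1 <= z <= 2 -> 1 <= t ->
  Gamma_integrand z t <= t * exp (- t).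
Proof.
intros Hz Ht; apply Rmult_le_compat_r; [apply Rlt_le, exp_pos|].
rewrite <- (Rpower_1 t) at 2 by lra.
apply Rle_Rpower; lra.
Qed.

Lemma Gamma_integrand_le_left z t : 1 <= z -> 0 < t <= 1 ->
  Gamma_integrand z t <= 1.
Proof.
intros Hz Ht; unfold Gamma_integrand.
assert (h1 := Rpower_le_1_left t (z - 1) Ht ltac:(lra)).
assert (h2 : exp (- t) <= 1).
{ rewrite <- exp_0; apply Rlt_le, exp_increasing; lra. }
assert (h3 : 0 < exp (- t)) by apply exp_pos.
assert (h4 : 0 < Rpower t (z - 1)) by apply exp_pos.
nra.
Qed.

(** On the strip [1 <= z <= 2] the integrand is at most 1 on [(0, 1]] and at most
    [t e^{-t}] beyond; larger [z] follow by integration by parts. *)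
Lemma ex_Gamma_strip z : 1 <= z <= 2 ->
  ex_RInt_gen (Gamma_integrand z) (at_right 0) (Rbar_locally p_infty).
Proof.
intros Hz; apply ex_RInt_gen_Chasles with 1.
(* The lower end is sent to infinity by [a = 1/y]. *)
- destruct (monotone_bounded_limit
    (fun y => RInt (Gamma_integrand z) (/ y) 1) 1 1) as [l Hl].
  + intros x y Hxy.
    assert (/ y <= / x) by (apply Rinv_le_contravar; lra).
    assert (0 < / y) by (apply Rinv_0_lt_compat; lra).
    assert (/ x <= 1) by (rewrite <- Rinv_1; apply Rinv_le_contravar; lra).
    apply RInt_Gamma_integrand_mono; lra.
  + intros x Hx.
    assert (0 < / x) by (apply Rinv_0_lt_compat; lra).
    assert (/ x <= 1) by (rewrite <- Rinv_1; apply Rinv_le_contravar; lra).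
    apply Rle_trans with (RInt (fun _ => 1) (/ x) 1).
    * apply RInt_le; [lra| | |].
      -- apply ex_RInt_Gamma_integrand; lra.
      -- apply ex_RInt_const.
      -- intros t Ht; apply Gamma_integrand_le_left; lra.
    * rewrite RInt_const; unfold scal; simpl; unfold mult; simpl; lra.
  + exists l; intros P HP.
    apply Filter_prod with (fun a => 0 < a /\ P (RInt (Gamma_integrand z) a 1))
                           (fun b => b = 1).
    * assert (H := filterlim_comp _ _ _ _ _ _ _ _ filterlim_Rinv_0_right Hl P HP).
      unfold filtermap in H.
      assert (Hpos : at_right 0 (fun a => 0 < a)).
      { exists (mkposreal 1 Rlt_0_1); intros y _ Hy; exact Hy. }
      generalize (filter_and _ _ H Hpos); apply filter_imp.
      intros a [H1 H2]; split; [exact H2|]; rewrite Rinv_inv in H1; exact H1.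
    * reflexivity.
    * intros a b [Ha HPa] ->; exists (RInt (Gamma_integrand z) a 1).
      split; [|exact HPa].
      apply (RInt_correct (V := R_CompleteNormedModule)), ex_RInt_Gamma_integrand; simpl; lra.
- destruct (monotone_bounded_limit
    (fun y => RInt (Gamma_integrand z) 1 y) 1 2) as [l Hl].
  + intros x y Hxy; apply RInt_Gamma_integrand_mono; lra.
  + intros x Hx.
    (* The integral of [t e^{-t}] from 1 to [x], with primitive [- (t + 1) e^{-t}]. *)
    apply Rle_trans with (2 * exp (Ropp 1) - (x + 1) * exp (- x)).
    * assert (Hc : forall t, continuous (fun t => t * exp (- t)) t).
      { intros t; apply (ex_derive_continuous (fun t => t * exp (- t)));
          auto_derive; exact I. }
      apply Rle_trans with (RInt (fun t => t * exp (- t)) 1 x).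
      { apply RInt_le; [lra|apply ex_RInt_Gamma_integrand; lra| |].
        - apply (ex_RInt_continuous (V := R_CompleteNormedModule)); intros t _; apply Hc.
        - intros t Ht; apply Gamma_integrand_le_right; lra. }
      right; apply is_RInt_unique.
      replace (2 * exp (Ropp 1) - (x + 1) * exp (- x))
        with (minus ((fun t => - (t + 1) * exp (- t)) x)
                    ((fun t => - (t + 1) * exp (- t)) 1))
        by (unfold minus, plus, opp; simpl; ring).
      apply (is_RInt_derive (V := R_CompleteNormedModule)
               (fun t => - (t + 1) * exp (- t))).
      -- intros t _; auto_derive; [exact I|ring].
      -- intros t _; apply Hc.
    * assert (0 < exp (- x)) by apply exp_pos.
      assert (exp (Ropp 1) < 1) by (rewrite <- exp_0 at 2; apply exp_increasing; lra).
      nra.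
  + exists l; intros P HP.
    apply Filter_prod with (fun a => a = 1)
      (fun b => 1 < b /\ P (RInt (Gamma_integrand z) 1 b)).
    * reflexivity.
    * assert (Hpos : Rbar_locally p_infty (fun b => 1 < b)) by (exists 1; auto).
      generalize (filter_and _ _ Hpos (Hl P HP)); apply filter_imp; auto.
    * intros a b -> [Hb HPb]; exists (RInt (Gamma_integrand z) 1 b).
      split; [|exact HPb].
      apply (RInt_correct (V := R_CompleteNormedModule)), ex_RInt_Gamma_integrand; simpl; lra.
Qed.

Lemma is_derive_Gamma_boundary z t : 0 < t ->
  is_derive (fun t => - (Rpower t z * exp (- t))) t
            (Gamma_integrand (z + 1) t - z * Gamma_integrand z t).
Proof.
intros Ht; unfold Gamma_integrand, Rpower; auto_derive; [lra|].
replace (z + 1 - 1) with z by ring.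
replace ((z - 1) * ln t) with (z * ln t + - ln t) by ring.
rewrite exp_plus, (exp_Ropp (ln t)), exp_ln by lra; field; lra.
Qed.

(** From [ln u <= u] at [u = t / 2z], which gives
    [z ln t <= t/2 + z ln (2z)]. *)
Lemma Rpower_exp_decay z t : 0 < z -> 0 < t ->
  Rpower t z * exp (- t) <= exp (z * ln (2 * z)) * exp (- (t / 2)).
Proof.
intros Hz Ht; unfold Rpower; rewrite <- !exp_plus.
assert (Hle : z * ln t + - t <= z * ln (2 * z) + - (t / 2)).
{ assert (H : ln (t / (2 * z)) <= t / (2 * z)).
  { assert (0 < t / (2 * z)) by (apply Rdiv_lt_0_compat; lra).
    rewrite <- (ln_exp (t / (2 * z))) at 2; apply ln_le; [assumption|].
    generalize (exp_ineq1_le (t / (2 * z))); lra. }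
  unfold Rdiv in H at 1; rewrite ln_mult, ln_Rinv in H;
    try (apply Rinv_0_lt_compat); try lra.
  assert (H2 : z * (t / (2 * z)) = t / 2) by (field; lra).
  assert (z * (ln t + - ln (2 * z)) <= z * (t / (2 * z)))
    by (apply Rmult_le_compat_l; lra).
  lra. }
destruct Hle as [Hlt|Heq]; [left; apply exp_increasing; exact Hlt|right; rewrite Heq; reflexivity].
Qed.

(** Integration by parts: the integrands at [z + 1] and at [z] differ by the
    derivative of [- t^z e^{-t}], which vanishes at both ends. *)
Lemma is_Gamma_succ z g : 1 <= z ->
  is_RInt_gen (Gamma_integrand z) (at_right 0) (Rbar_locally p_infty) g ->
  is_RInt_gen (Gamma_integrand (z + 1)) (at_right 0) (Rbar_locally p_infty) (z * g).
Proof.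
intros Hz Hg.
set (F := fun t => - (Rpower t z * exp (- t))).
assert (Hpos : filter_prod (at_right 0) (Rbar_locally p_infty)
   (fun ab : R * R => forall x, Rmin (fst ab) (snd ab) <= x <= Rmax (fst ab) (snd ab) -> 0 < x)).
{ apply Filter_prod with (fun a => 0 < a) (fun b => 0 < b).
  - exists (mkposreal 1 Rlt_0_1); intros y _ Hy; exact Hy.
  - exists 0; auto.
  - intros a b Ha Hb x [Hx _]; simpl in Hx.
    apply Rlt_le_trans with (2 := Hx); apply Rmin_glb_lt; assumption. }
assert (HDloc : forall x, 0 < x -> locally x (fun t =>
   Gamma_integrand (z + 1) t - z * Gamma_integrand z t = Derive F t)).
{ intros x Hx; exists (mkposreal x Hx); intros t Ht.
  symmetry; apply is_derive_unique, is_derive_Gamma_boundary.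
  apply Rabs_def2 in Ht; unfold minus, plus, opp in Ht; simpl in Ht; lra. }
assert (HF : is_RInt_gen (Derive F) (at_right 0) (Rbar_locally p_infty) (0 - 0)).
{ apply is_RInt_gen_Derive.
  - revert Hpos; apply filter_imp; intros ab H x Hx.
    eexists; apply is_derive_Gamma_boundary; apply H; exact Hx.
  - revert Hpos; apply filter_imp; intros ab H x Hx; specialize (H x Hx).
    apply continuous_ext_loc with (1 := HDloc x H).
    apply (continuous_minus (V := R_NormedModule)).
    + apply continuous_Gamma_integrand; exact H.
    + apply (continuous_scal_r (V := R_NormedModule) z), continuous_Gamma_integrand; exact H.
  - apply filterlim_locally; intros eps.
    exists (mkposreal (Rmin 1 eps) (Rmin_pos _ _ Rlt_0_1 (cond_pos eps))).
    intros t Ht Ht0.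
    apply Rabs_def2 in Ht; unfold minus, plus, opp in Ht; simpl in Ht.
    assert (h1 := Rmin_l 1 eps); assert (h2 := Rmin_r 1 eps).
    assert (Hp : Rpower t z * exp (- t) <= t * 1).
    { assert (Ht' : t * Gamma_integrand z t = Rpower t z * exp (- t)).
      { unfold Gamma_integrand; replace z with (1 + (z - 1)) at 2 by ring.
        rewrite Rpower_plus, Rpower_1 by lra; ring. }
      rewrite <- Ht'; apply Rmult_le_compat_l; [lra|].
      apply Gamma_integrand_le_left; lra. }
    assert (0 < Rpower t z * exp (- t)) by (apply Rmult_lt_0_compat; apply exp_pos).
    apply Rabs_def1; unfold F, minus, plus, opp; simpl; lra.
  - apply filterlim_locally; intros eps.
    set (K := exp (z * ln (2 * z))).
    assert (HK : 0 < K) by apply exp_pos.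
    exists (2 * K / eps); intros t Ht.
    assert (Heps := cond_pos eps).
    assert (Ht0 : 0 < t).
    { apply Rlt_trans with (2 := Ht); apply Rdiv_lt_0_compat; lra. }
    assert (Hd := Rpower_exp_decay z t ltac:(lra) Ht0); fold K in Hd.
    assert (He : exp (- (t / 2)) < eps / K).
    { rewrite exp_Ropp.
      replace (eps / K) with (/ (K / eps)) by (field; lra).
      apply Rinv_0_lt_contravar.
      - apply Rdiv_lt_0_compat; lra.
      - assert (h := exp_ineq1_le (t / 2)).
        replace (2 * K / eps) with (2 * (K / eps)) in Ht by (field; lra); lra. }
    assert (Hlt : K * exp (- (t / 2)) < eps).
    { apply Rlt_le_trans with (K * (eps / K)).
      - apply Rmult_lt_compat_l; assumption.
      - right; field; lra. }
    assert (0 < Rpower t z * exp (- t)) by (apply Rmult_lt_0_compat; apply exp_pos).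
    apply Rabs_def1; unfold F, minus, plus, opp; simpl; lra. }
assert (Hs := is_RInt_gen_plus _ _ _ _ HF (is_RInt_gen_scal _ z _ Hg)).
replace (z * g) with (plus (0 - 0) (scal z g))
  by (unfold plus, scal; simpl; unfold mult; simpl; ring).
revert Hs; apply is_RInt_gen_ext.
revert Hpos; apply filter_imp; intros ab H x Hx.
assert (Hx0 : 0 < x) by (apply H; lra).
assert (HD := locally_singleton _ _ (HDloc x Hx0)).
rewrite <- HD; unfold plus, scal; simpl; unfold mult; simpl; ring.
Qed.

Lemma ex_Gamma z : 1 <= z ->
  ex_RInt_gen (Gamma_integrand z) (at_right 0) (Rbar_locally p_infty).
Proof.
intros Hz.
destruct (nfloor_ex (z - 1) ltac:(lra)) as [p Hp].
revert z Hz Hp; induction p as [|p IH]; intros z Hz Hp.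
- apply ex_Gamma_strip; simpl in Hp; lra.
- rewrite S_INR in Hp; assert (Hp0 := pos_INR p).
  destruct (IH (z - 1)) as [g Hg]; [lra|lra|].
  exists ((z - 1) * g).
  replace z with (z - 1 + 1) at 1 by ring.
  apply is_Gamma_succ; [lra|exact Hg].
Qed.

Lemma is_Gamma z : 1 <= z ->
  is_RInt_gen (Gamma_integrand z) (at_right 0) (Rbar_locally p_infty) (Gamma z).
Proof.
intros Hz; apply (RInt_gen_correct (V := R_CompleteNormedModule)), ex_Gamma, Hz.
Qed.

Lemma Gamma_succ z : 1 <= z -> Gamma (z + 1) = z * Gamma z.
Proof.
intros Hz; apply (is_RInt_gen_unique (V := R_CompleteNormedModule)
  (Gamma_integrand (z + 1))).
apply is_Gamma_succ, is_Gamma; exact Hz.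
Qed.

Lemma Gamma_1 : Gamma 1 = 1.
Proof.
apply (is_RInt_gen_unique (V := R_CompleteNormedModule) (Gamma_integrand 1)).
replace 1 with (0 - - 1) at 2 by ring.
set (F := fun t : R => - exp (- t)).
assert (HD : forall t, is_derive F t (Gamma_integrand 1 t)).
{ intros t; unfold F, Gamma_integrand, Rpower; auto_derive; [exact I|].
  replace ((1 - 1) * ln t) with 0 by ring; rewrite exp_0; ring. }
apply is_RInt_gen_ext with (Derive F).
- apply filter_forall; intros ab x _; apply is_derive_unique, HD.
- apply is_RInt_gen_Derive.
  + apply filter_forall; intros ab x _; eexists; apply HD.
  + apply filter_forall; intros ab x _.
    apply continuous_ext with (fun t => exp (- t)).
    * intros t; symmetry; apply is_derive_unique; unfold F; auto_derive; [exact I|ring].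
    * apply (ex_derive_continuous (fun t => exp (- t))); auto_derive; exact I.
  + replace (- 1) with (F 0) by (unfold F; rewrite Ropp_0, exp_0; ring).
    apply (filterlim_filter_le_1 F (F := locally 0) (G := at_right 0)); [apply filter_le_within|].
    apply (ex_derive_continuous F); eexists; apply HD.
  + apply filterlim_locally; intros eps; exists (/ eps); intros t Ht.
    assert (Heps := cond_pos eps).
    assert (0 < / eps) by (apply Rinv_0_lt_compat; assumption).
    assert (exp (- t) < eps).
    { rewrite exp_Ropp, <- (Rinv_inv eps).
      apply Rinv_0_lt_contravar; [assumption|].
      generalize (exp_ineq1_le t); lra. }
    assert (0 < exp (- t)) by apply exp_pos.
    apply Rabs_def1; unfold F, minus, plus, opp; simpl; lra.
Qed.

Lemma Gamma_fact m : Gamma (INR m + 1) = INR (fact m).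
Proof.
induction m as [|m IH].
- simpl; rewrite Rplus_0_l; exact Gamma_1.
- rewrite S_INR, Gamma_succ, IH, fact_simpl, mult_INR, S_INR;
    [ring|generalize (pos_INR m); lra].
Qed.

(** The integral over [(0, oo)] is a limit of integrals over intervals that
    contain [[1, 2]], hence at least the integral over [[1, 2]]. *)
Lemma Gamma_pos z : 1 <= z -> 0 < Gamma z.
Proof.
intros Hz; set (c := RInt (Gamma_integrand z) 1 2).
assert (Hc : 0 < c).
{ apply RInt_gt_0; [lra| |].
  - intros t _; apply Gamma_integrand_pos.
  - intros t Ht; apply continuous_Gamma_integrand; lra. }
apply Rlt_le_trans with (1 := Hc).
destruct (Rle_lt_dec c (Gamma z)) as [H|H]; [exact H|exfalso].
assert (HB : locally (Gamma z) (fun y => y < c)).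
{ exists (mkposreal (c - Gamma z) ltac:(lra)); intros y Hy.
  apply Rabs_def2 in Hy; unfold minus, plus, opp in Hy; simpl in Hy; lra. }
assert (Hf := is_Gamma z Hz (fun y => y < c) HB); unfold filtermapi in Hf.
assert (Hab : filter_prod (at_right 0) (Rbar_locally p_infty)
   (fun ab : R * R => 0 < fst ab <= 1 /\ 2 <= snd ab)).
{ apply Filter_prod with (fun a => 0 < a <= 1) (fun b => 2 <= b).
  - exists (mkposreal 1 Rlt_0_1); intros y Hy Hy0.
    apply Rabs_def2 in Hy; unfold minus, plus, opp in Hy; simpl in Hy; lra.
  - exists 2; intros; lra.
  - simpl; auto. }
destruct (filter_ex _ (filter_and _ _ Hf Hab)) as [[a b] [[I [HI HIc]] [Ha Hb]]].
simpl in *.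
apply (is_RInt_unique (V := R_CompleteNormedModule)) in HI; rewrite <- HI in HIc.
assert (c <= RInt (Gamma_integrand z) a b); [|lra].
apply RInt_Gamma_integrand_mono; lra.
Qed.

(** * The Jacobi-Anger expansion *)

Lemma cis_mult a b : (cis a * cis b)%C = cis (a + b).
Proof.
unfold cis; apply C_ext; unfold Cmult; simpl.
- rewrite cos_plus; reflexivity.
- rewrite sin_plus; ring.
Qed.

Lemma cis_pow t m : (cis t ^ m)%C = cis (INR m * t).
Proof.
induction m as [|m IH].
- simpl; rewrite Rmult_0_l; unfold cis; rewrite cos_0, sin_0; reflexivity.
- rewrite Cpow_S, IH, cis_mult, S_INR; f_equal; ring.
Qed.

Lemma cos_sin_2PI_nat t : cos (INR t * (2 * PI)) = 1 /\ sin (INR t * (2 * PI)) = 0.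
Proof.
assert (E : INR t * (2 * PI) = 0 + 2 * INR t * PI) by ring; rewrite E.
rewrite cos_period, sin_period, cos_0, sin_0; split; reflexivity.
Qed.

Lemma is_RInt_Cmult (c : C) (f : R -> C) a b (l : C) :
  is_RInt (V := C_R_NormedModule) f a b l ->
  is_RInt (V := C_R_NormedModule) (fun t => c * f t)%C a b (c * l)%C.
Proof.
intros H.
assert (H1 := is_RInt_fct_extend_fst (U := R_NormedModule) (V := R_NormedModule) _ _ _ _ H).
assert (H2 := is_RInt_fct_extend_snd (U := R_NormedModule) (V := R_NormedModule) _ _ _ _ H).
apply (is_RInt_fct_extend_pair (U := R_NormedModule) (V := R_NormedModule)).
- exact (is_RInt_minus _ _ _ _ _ _ (is_RInt_scal _ _ _ (fst c) _ H1)
           (is_RInt_scal _ _ _ (snd c) _ H2)).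
- exact (is_RInt_plus _ _ _ _ _ _ (is_RInt_scal _ _ _ (fst c) _ H2)
           (is_RInt_scal _ _ _ (snd c) _ H1)).
Qed.

Lemma is_RInt_cis (q r : nat) :
  is_RInt (V := C_R_NormedModule)
    (fun t => cis (- t) ^ r * cis t ^ q)%C 0 (2 * PI)
    (RtoC (if Nat.eqb q r then 2 * PI else 0)).
Proof.
apply is_RInt_ext with (fun t => cis ((INR q - INR r) * t)).
{ intros t _; rewrite !cis_pow, cis_mult; f_equal; ring. }
destruct (Nat.eqb_spec q r) as [->|Hqr].
- apply (is_RInt_fct_extend_pair (U := R_NormedModule) (V := R_NormedModule));
    simpl; [replace (2 * PI) with (scal (2 * PI - 0) 1) at 2
           |replace 0 with (scal (2 * PI - 0) 0) at 2];
    try (unfold scal; simpl; unfold mult; simpl; ring);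
    (eapply is_RInt_ext; [|apply (is_RInt_const (V := R_NormedModule))]);
    intros t _; simpl; replace ((INR r - INR r) * t) with 0 by ring;
    rewrite ?cos_0, ?sin_0; reflexivity.
- set (d := INR q - INR r).
  assert (Hd : d <> 0) by (intros E; apply Hqr, INR_eq; unfold d in E; lra).
  assert (Hper : cos (d * (2 * PI)) = 1 /\ sin (d * (2 * PI)) = 0).
  { unfold d; rewrite Rmult_minus_distr_r, cos_minus, sin_minus.
    destruct (cos_sin_2PI_nat q) as [-> ->], (cos_sin_2PI_nat r) as [-> ->]; lra. }
  destruct Hper as [Hc Hs].
  assert (H : forall F f : R -> R, F (2 * PI) = F 0 ->
     (forall t, is_derive F t (f t)) -> (forall t, continuous f t) ->
     is_RInt f 0 (2 * PI) 0).
  { intros F f HF HD Hf; replace 0 with (minus (F (2 * PI)) (F 0)) at 2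
      by (rewrite HF; unfold minus, plus, opp; simpl; ring).
    apply (is_RInt_derive (V := R_CompleteNormedModule) F); intros t _; auto. }
  apply (is_RInt_fct_extend_pair (U := R_NormedModule) (V := R_NormedModule)).
  + apply (H (fun t => sin (d * t) / d)).
    * rewrite Hs, Rmult_0_r, sin_0; reflexivity.
    * intros t; auto_derive; [exact I|simpl; field; exact Hd].
    * intros t; apply (ex_derive_continuous (fun t => cos (d * t))); auto_derive; exact I.
  + apply (H (fun t => - cos (d * t) / d)).
    * rewrite Hc, Rmult_0_r, cos_0; reflexivity.
    * intros t; auto_derive; [exact I|simpl; field; exact Hd].
    * intros t; apply (ex_derive_continuous (fun t => sin (d * t))); auto_derive; exact I.
Qed.

Lemma is_RInt_sum_n (f : nat -> R -> C) a b (l : nat -> C) P :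
  (forall p, is_RInt (V := C_R_NormedModule) (f p) a b (l p)) ->
  is_RInt (V := C_R_NormedModule)
    (fun t => @sum_n C_AbelianMonoid (fun p => f p t) P) a b (@sum_n C_AbelianMonoid l P).
Proof.
intros H; induction P as [|P IH].
- rewrite sum_O; apply is_RInt_ext with (2 := H O); intros t _; rewrite sum_O; reflexivity.
- rewrite sum_Sn; apply is_RInt_ext with (2 := is_RInt_plus _ _ _ _ _ _ IH (H (S P))).
  intros t _; rewrite sum_Sn; reflexivity.
Qed.

Lemma Ci_pow_even j : (Ci ^ (2 * j))%C = RtoC ((-1) ^ j).
Proof.
rewrite Cpow_mult_r, RtoC_pow; f_equal.
apply C_ext; simpl; ring.
Qed.

Lemma divpow_Ci (u : R) p :
  divpow (Ci * u) p = (RtoC (/ INR (fact p) * u ^ p) * Ci ^ p)%C.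
Proof.
unfold divpow; rewrite Cpow_mult_l, RtoC_mult, <- RtoC_pow; ring.
Qed.

Lemma Ci_pow_odd j : (Ci ^ (2 * j + 1))%C = (RtoC ((-1) ^ j) * Ci)%C.
Proof. rewrite Cpow_add_r, Ci_pow_even, Cpow_1_r; reflexivity. Qed.

Lemma is_series_zero : is_series (fun _ : nat => 0) 0.
Proof.
apply filterlim_ext with (fun _ => 0); [|apply filterlim_const].
intros P; rewrite sum_n_const; ring.
Qed.

(** Even powers of [i] are real and odd ones imaginary, so the exponential
    series at [iu] splits into the defining series of [cos] and [sin]. *)
Lemma is_series_cis (u : R) :
  is_series (fun p => Re (divpow (Ci * u) p)) (cos u) /\
  is_series (fun p => Im (divpow (Ci * u) p)) (sin u).
Proof.
split.
- apply is_series_ext with (fun p => (Re (Ci ^ p)%C / INR (fact p)) * u ^ p).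
  { intros p; rewrite divpow_Ci; unfold Re, Im, Rdiv; simpl; ring. }
  apply is_pseries_R.
  replace (cos u) with (cos u + u * 0) by ring.
  apply is_pseries_odd_even; apply is_pseries_R.
  + unfold cos; destruct (exist_cos (Rsqr u)) as [l Hl].
    apply is_series_Reals in Hl; revert Hl; apply is_series_ext; intros j.
    rewrite Ci_pow_even, Rsqr_pow2; reflexivity.
  + apply is_series_ext with (2 := is_series_zero); intros j.
    rewrite Ci_pow_odd; unfold Re, Rdiv; simpl; ring.
- apply is_series_ext with (fun p => (Im (Ci ^ p)%C / INR (fact p)) * u ^ p).
  { intros p; rewrite divpow_Ci; unfold Re, Im, Rdiv; simpl; ring. }
  apply is_pseries_R.
  unfold sin; destruct (exist_sin (Rsqr u)) as [l Hl].
  replace (u * l) with (0 + u * l) by ring.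
  apply is_pseries_odd_even; apply is_pseries_R.
  + apply is_series_ext with (2 := is_series_zero); intros j.
    rewrite Ci_pow_even; unfold Im, Rdiv; simpl; ring.
  + apply is_series_Reals in Hl; revert Hl; apply is_series_ext; intros j.
    rewrite Ci_pow_odd, Rsqr_pow2.
    replace (Im (RtoC ((-1) ^ j) * Ci)%C) with ((-1) ^ j) by (unfold Im; simpl; ring).
    reflexivity.
Qed.

Lemma is_series_exp (u : R) : is_series (fun p => / INR (fact p) * u ^ p) (exp u).
Proof. apply is_pseries_R, is_exp_Reals. Qed.

(** Turns one convergent dominating series into a rate of convergence that is
    uniform over all dominated ones. *)
Lemma series_remainder_le (a b : nat -> R) (la lb : R) P :
  (forall p, Rabs (a p) <= b p) -> is_series a la -> is_series b lb ->
  Rabs (la - sum_n a P) <= lb - sum_n b P.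
Proof.
intros Hab Ha Hb.
assert (Htail : forall (c : nat -> R) (l : R), is_series c l ->
  is_series (fun k => c (S P + k)%nat) (l - sum_n c P)).
{ intros c l Hc; apply (is_series_incr_n (V := R_NormedModule)); [lia|].
  assert (E : l = l - sum_n c P + sum_n c P) by ring.
  exact (eq_ind l (fun y => is_series c y) Hc _ E). }
assert (A := Htail a la Ha); assert (B := Htail b lb Hb).
rewrite <- (is_series_unique _ _ A), <- (is_series_unique _ _ B).
assert (E : ex_series (fun k => Rabs (a (S P + k)%nat))).
{ apply (ex_series_le (V := R_CompleteNormedModule)) with (fun k => b (S P + k)%nat).
  - intros k; unfold norm; simpl; unfold abs; simpl; rewrite Rabs_Rabsolu; apply Hab.
  - eexists; exact B. }
apply Rle_trans with (1 := Series_Rabs _ E).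
apply Series_le; [|eexists; exact B].
intros k; split; [apply Rabs_pos|apply Hab].
Qed.

Lemma Cmod_divpow (z : C) p : Cmod (divpow z p) = / INR (fact p) * Cmod z ^ p.
Proof.
unfold divpow; rewrite Cmod_mult, Cmod_pow, Cmod_R, Rabs_pos_eq; [reflexivity|].
apply Rlt_le, Rinv_0_lt_compat, INR_fact_pos.
Qed.

Lemma im_le_Cmod (z : C) : Rabs (Im z) <= Cmod z.
Proof. apply Rle_trans with (2 := Rmax_Cmod z), Rmax_r. Qed.

Lemma cis_taylor_uniform (U : R) (eps : posreal) :
  eventually (fun P => forall u, Rabs u <= U ->
    Rabs (cos u - Re (sum_n (divpow (Ci * u)) P)) < eps /\
    Rabs (sin u - Im (sum_n (divpow (Ci * u)) P)) < eps).
Proof.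
assert (H := is_series_exp U).
assert (Hl : locally (exp U) (fun y => Rabs (y - exp U) < eps)) by (exists eps; auto).
generalize (H _ Hl); unfold filtermap; apply filter_imp.
intros P HP u Hu.
assert (Hb : forall p, Cmod (divpow (Ci * u) p) <= / INR (fact p) * U ^ p).
{ intros p; rewrite Cmod_divpow, Cmod_mult, Cmod_Ci, Cmod_R, Rmult_1_l.
  apply Rmult_le_compat_l; [apply Rlt_le, Rinv_0_lt_compat, INR_fact_pos|].
  apply pow_incr; split; [apply Rabs_pos|exact Hu]. }
destruct (is_series_cis u) as [Hc Hs].
rewrite Re_sum_n, Im_sum_n.
assert (Htail : exp U - sum_n (fun p => / INR (fact p) * U ^ p) P < eps).
{ assert (HP' : Rabs (sum_n (fun p => / INR (fact p) * U ^ p) P - exp U) < eps) by exact HP.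
  apply Rabs_def2 in HP'; lra. }
split; (eapply Rle_lt_trans; [eapply series_remainder_le; [|eassumption|exact H]|]).
- intros p; apply Rle_trans with (2 := Hb p), re_le_Cmod.
- exact Htail.
- intros p; apply Rle_trans with (2 := Hb p), im_le_Cmod.
- exact Htail.
Qed.

(** Coefficients of [(2/t)^m m! J_m(t)] as a power series in [(t/2)^2]. The
    factor [m!] makes them at most [1/j!] in absolute value for every [m]. *)
Definition bessel_coef (m j : nat) : R :=
  (-1) ^ j * (INR (fact m) / (INR (fact j) * INR (fact (m + j)))).

Definition Bessel_series (m : nat) (v : R) : R := PSeries (bessel_coef m) v.

Lemma bessel_coef_bound m j : Rabs (bessel_coef m j) <= / INR (fact j).
Proof.
unfold bessel_coef; rewrite Rabs_mult, pow_1_abs, Rmult_1_l.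
assert (h1 := INR_fact_pos m); assert (h2 := INR_fact_pos j).
assert (h3 : INR (fact m) <= INR (fact (m + j))) by (apply le_INR, fact_le; lia).
rewrite Rabs_pos_eq.
- apply Rmult_le_reg_r with (INR (fact j) * INR (fact (m + j))); [nra|].
  field_simplify; [exact h3|lra|lra].
- apply Rdiv_le_0_compat; [lra|nra].
Qed.

Lemma ex_Bessel_series m v : ex_series (fun j => bessel_coef m j * v ^ j).
Proof.
apply (ex_series_le (V := R_CompleteNormedModule)) with (fun j => / INR (fact j) * Rabs v ^ j).
- intros j; unfold norm; simpl; unfold abs; simpl; rewrite Rabs_mult, <- RPow_abs.
  apply Rmult_le_compat_r; [apply pow_le, Rabs_pos|apply bessel_coef_bound].
- eexists; apply is_series_exp.
Qed.

(** The two factors [i k x / 2] and [i k (conj x) / 2] have the real product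
    [- (k|x|/2)^2]; [j] such pairs leave [m] factors [i k x / 2]. *)
Lemma divpow_diagonal (k : R) (x : C) m j :
  (divpow (Ci * k * x / 2) (j + m) * divpow (Ci * k * Cconj x / 2) j)%C =
  (divpow (Ci * k * x / 2) m * RtoC (bessel_coef m j * ((k * Cmod x / 2) ^ 2) ^ j))%C.
Proof.
unfold divpow, bessel_coef.
assert (Hx : ((Ci * k * x / 2) * (Ci * k * Cconj x / 2))%C = RtoC (- (k * Cmod x / 2) ^ 2)).
{ transitivity ((Ci * Ci) * RtoC (k * k / 4) * (x * Cconj x))%C.
  - unfold Rdiv; rewrite !RtoC_mult, RtoC_inv by lra.
    field; split; apply RtoC_neq_0; lra.
  - rewrite <- Cmod2_conj; apply C_ext; unfold Re, Im; simpl; field. }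
rewrite Cpow_add_r.
transitivity (RtoC (/ INR (fact (j + m))) * RtoC (/ INR (fact j)) *
  (Ci * k * x / 2) ^ m * ((Ci * k * x / 2) * (Ci * k * Cconj x / 2)) ^ j)%C.
{ rewrite Cpow_mult_l; ring. }
rewrite Hx, <- RtoC_pow.
replace ((- (k * Cmod x / 2) ^ 2) ^ j)
  with ((-1) ^ j * ((k * Cmod x / 2) ^ 2) ^ j)
  by (rewrite <- Rpow_mult_distr; f_equal; ring).
rewrite (PeanoNat.Nat.add_comm j m).
assert (h1 := INR_fact_pos m); assert (h2 := INR_fact_pos j).
assert (h3 := INR_fact_pos (m + j)).
transitivity ((Ci * k * x / 2) ^ m * RtoC (/ INR (fact (m + j)) * / INR (fact j) *
   ((-1) ^ j * ((k * Cmod x / 2) ^ 2) ^ j)))%C.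
{ rewrite !RtoC_mult; ring. }
transitivity ((Ci * k * x / 2) ^ m * RtoC (/ INR (fact m) *
  ((-1) ^ j * (INR (fact m) / (INR (fact j) * INR (fact (m + j)))) *
   ((k * Cmod x / 2) ^ 2) ^ j)))%C.
{ do 2 f_equal; field; lra. }
rewrite (RtoC_mult (/ INR (fact m))); ring.
Qed.

(** The exponent as a sum of multiples of [conj phi] and [phi], for
    [phi = cis t], so that its powers are trigonometric polynomials. *)
Lemma Ci_dot (k : R) (x : C) (t : R) :
  (Ci * RtoC (k * dot x (cis t)))%C =
  (Ci * k * x / 2 * cis (- t) + Ci * k * Cconj x / 2 * cis t)%C.
Proof.
destruct x as [x1 x2]; unfold dot, cis; rewrite cos_neg, sin_neg.
apply C_ext; unfold Re, Im; simpl; field.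
Qed.

Lemma dot_cis_bound (k : R) (x : C) t :
  Rabs (k * dot x (cis t)) <= Rabs k * (Rabs (fst x) + Rabs (snd x)).
Proof.
rewrite Rabs_mult; apply Rmult_le_compat_l; [apply Rabs_pos|].
unfold dot, cis; simpl.
apply Rle_trans with (1 := Rabs_triang _ _); rewrite !Rabs_mult.
assert (h1 := Rabs_pos (fst x)); assert (h2 := Rabs_pos (snd x)).
assert (h3 : Rabs (cos t) <= 1) by (apply Rabs_le; apply COS_bound).
assert (h4 : Rabs (sin t) <= 1) by (apply Rabs_le; apply SIN_bound).
nra.
Qed.

(** Termwise integration by orthogonality of the characters: the product of [q]
    factors [phi], [p - q] factors [conj phi] and [phi^m] has nonzero mean only if
    [q + m = p - q]. *)
Lemma truncated_circle_integral (k : R) (x : C) m P :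
  is_RInt (V := C_R_NormedModule)
    (fun t => @sum_n C_AbelianMonoid (divpow (Ci * RtoC (k * dot x (cis t)))) P * cis t ^ m)%C
    0 (2 * PI)
    (@sum_n C_AbelianMonoid (fun p => @sum_n C_AbelianMonoid (fun q =>
       divpow (Ci * k * x / 2) (p - q) * divpow (Ci * k * Cconj x / 2) q
       * RtoC (if Nat.eqb (q + m) (p - q) then 2 * PI else 0))%C p) P).
Proof.
set (a := (Ci * k * x / 2)%C); set (b := (Ci * k * Cconj x / 2)%C).
apply is_RInt_ext with (fun t => @sum_n C_AbelianMonoid (fun p => @sum_n C_AbelianMonoid (fun q =>
   divpow a (p - q) * divpow b q * (cis (- t) ^ (p - q) * cis t ^ (q + m)))%C p) P).
{ intros t _; C_eq; rewrite Cmult_comm, Cmult_sum_n; apply sum_n_ext; intros p.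
  rewrite Ci_dot; fold a b; rewrite divpow_plus, Cmult_sum_n; apply sum_n_ext; intros q.
  unfold divpow; rewrite !Cpow_mult_l, Cpow_add_r; C_eq; ring. }
apply is_RInt_sum_n; intros p.
apply is_RInt_sum_n; intros q.
apply is_RInt_Cmult, is_RInt_cis.
Qed.

Lemma truncated_circle_integral_value (k : R) (x : C) m J :
  sum_n (fun p => sum_n (fun q =>
       divpow (Ci * k * x / 2) (p - q) * divpow (Ci * k * Cconj x / 2) q
       * RtoC (if Nat.eqb (q + m) (p - q) then 2 * PI else 0))%C p) (2 * J + m) =
  (RtoC (2 * PI) * divpow (Ci * k * x / 2) m *
   RtoC (sum_n (fun j => bessel_coef m j * ((k * Cmod x / 2) ^ 2) ^ j)%R J))%C.
Proof.
rewrite sum_n_supported.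
- transitivity (sum_n (fun j => RtoC (2 * PI) * divpow (Ci * k * x / 2) m *
     RtoC (bessel_coef m j * ((k * Cmod x / 2) ^ 2) ^ j))%C J).
  + apply sum_n_ext; intros j; rewrite (sum_n_single _ j).
    * replace (2 * j + m - j)%nat with (j + m)%nat by lia.
      rewrite PeanoNat.Nat.eqb_refl, divpow_diagonal; C_eq; ring.
    * lia.
    * intros q Hq Hqj; replace (Nat.eqb (q + m) (2 * j + m - q)) with false
        by (symmetry; apply PeanoNat.Nat.eqb_neq; lia).
      unfold zero; simpl; C_eq; ring.
  + rewrite <- Cmult_sum_n; f_equal; apply C_ext; rewrite ?Re_sum_n, ?Im_sum_n.
    * reflexivity.
    * transitivity (zero : R_AbelianMonoid); [apply sum_n_eq_zero|]; reflexivity.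
- intros p Hp; apply sum_n_eq_zero; intros q Hq.
  replace (Nat.eqb (q + m) (p - q)) with false
    by (symmetry; apply PeanoNat.Nat.eqb_neq; intros E; apply (Hp q); lia).
  unfold zero; simpl; C_eq; ring.
Qed.

(** The truncations of the exponential converge uniformly on the circle, so their
    integrals converge; the limit is read off along the truncation orders
    [2J + m], where they are partial sums of the Bessel series. *)
Lemma Jacobi_Anger (k : R) (x : C) m :
  is_RInt (V := C_R_NormedModule)
    (fun t => cis (k * dot x (cis t)) * cis t ^ m)%C 0 (2 * PI)
    (RtoC (2 * PI) * divpow (Ci * k * x / 2) m *
     RtoC (Bessel_series m ((k * Cmod x / 2) ^ 2)))%C.
Proof.
set (f := fun t => (cis (k * dot x (cis t)) * cis t ^ m)%C).
destruct (filterlim_RInt (V := C_R_CompleteNormedModule) _ 0 (2 * PI) eventually _ f _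
  (truncated_circle_integral k x m)) as [If [Hlim Hint]].
- apply filterlim_locally; intros eps.
  generalize (cis_taylor_uniform (Rabs k * (Rabs (fst x) + Rabs (snd x)))
                (pos_div_2 eps)); apply filter_imp.
  intros P HP t; destruct (HP _ (dot_cis_bound k x t)) as [Hc Hs].
  unfold f; cbv beta; rewrite cis_pow.
  set (S := sum_n (divpow (Ci * RtoC (k * dot x (cis t)))) P) in *.
  set (u := k * dot x (cis t)) in *; set (v := INR m * t); clearbody S.
  assert (h1 : Rabs (cos v) <= 1) by (apply Rabs_le; apply COS_bound).
  assert (h2 : Rabs (sin v) <= 1) by (apply Rabs_le; apply SIN_bound).
  assert (Hprod : forall a b c d, Rabs a < eps / 2 -> Rabs b < eps / 2 ->
     Rabs c <= 1 -> Rabs d <= 1 -> Rabs (a * c + b * d) < eps).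
  { intros a b c d Ha Hb Hc' Hd; apply Rle_lt_trans with (1 := Rabs_triang _ _).
    rewrite !Rabs_mult.
    assert (h3 := Rabs_pos a); assert (h4 := Rabs_pos b); nra. }
  rewrite Rabs_minus_sym in Hc, Hs; simpl in Hc, Hs.
  split; unfold ball; simpl; unfold AbsRing_ball, abs, minus, plus, opp; simpl.
  + replace (_ + - _) with ((Re S - cos u) * cos v + (Im S - sin u) * - sin v)
      by (unfold Re, Im; ring).
    apply Hprod; auto; rewrite Rabs_Ropp; exact h2.
  + replace (_ + - _) with ((Re S - cos u) * sin v + (Im S - sin u) * cos v)
      by (unfold Re, Im; ring).
    apply Hprod; auto.
- set (K := (RtoC (2 * PI) * divpow (Ci * k * x / 2) m)%C).
  assert (Hsub : filterlim (fun J => 2 * J + m)%nat eventually eventually).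
  { intros Q [n0 Hn0]; exists n0; intros J HJ; apply Hn0; lia. }
  assert (HJ := filterlim_comp _ _ _ _ _ _ _ _ Hsub Hlim).
  assert (HL : is_lim_seq (sum_n (fun j => bessel_coef m j * ((k * Cmod x / 2) ^ 2) ^ j))
                 (Bessel_series m ((k * Cmod x / 2) ^ 2))).
  { apply (Series_correct _ (ex_Bessel_series m _)). }
  set (L := Bessel_series m ((k * Cmod x / 2) ^ 2)) in *.
  replace (K * RtoC L)%C with If; [exact Hint|].
  assert (Hfst : is_lim_seq (fun J => Re K * sum_n (fun j =>
      bessel_coef m j * ((k * Cmod x / 2) ^ 2) ^ j) J) (Re If)).
  { apply filterlim_locally; intros eps.
    generalize (proj1 (filterlim_locally _ _) HJ eps); apply filter_imp; intros J [H _].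
    rewrite truncated_circle_integral_value in H; fold K in H.
    refine (eq_ind _ (fun y => ball (Re If) eps y) H _ _); unfold Re; simpl; ring. }
  assert (Hsnd : is_lim_seq (fun J => Im K * sum_n (fun j =>
      bessel_coef m j * ((k * Cmod x / 2) ^ 2) ^ j) J) (Im If)).
  { apply filterlim_locally; intros eps.
    generalize (proj1 (filterlim_locally _ _) HJ eps); apply filter_imp; intros J [_ H].
    rewrite truncated_circle_integral_value in H; fold K in H.
    refine (eq_ind _ (fun y => ball (Im If) eps y) H _ _); unfold Im; simpl; ring. }
  apply is_lim_seq_unique in Hfst; apply is_lim_seq_unique in Hsnd.
  assert (E1 := is_lim_seq_unique _ _ (is_lim_seq_scal_l _ (Re K) _ HL)).
  assert (E2 := is_lim_seq_unique _ _ (is_lim_seq_scal_l _ (Im K) _ HL)).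
  rewrite Hfst in E1; rewrite Hsnd in E2.
  injection E1 as E1; injection E2 as E2.
  apply C_ext; [rewrite E1|rewrite E2]; unfold Re, Im; simpl; ring.
Qed.

(** * The error as the remainder of a series *)

Lemma BesselJ_normalized_eq m t :
  BesselJ_normalized m t = Bessel_series m ((t / 2) ^ 2).
Proof.
unfold BesselJ_normalized, Bessel_series; destruct (Req_EM_T t 0) as [->|Ht].
- replace ((0 / 2) ^ 2) with 0 by field; rewrite PSeries_0; unfold bessel_coef.
  rewrite PeanoNat.Nat.add_0_r; simpl fact; simpl INR.
  field; apply Rgt_not_eq, INR_fact_pos.
- unfold BesselJ, PSeries; rewrite <- Series_scal_l; apply Series_ext; intros j.
  unfold bessel_coef; rewrite pow_add, pow_mult.
  assert (h : (2 / t) ^ m * (t / 2) ^ m = 1).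
  { rewrite <- Rpow_mult_distr; replace (2 / t * (t / 2)) with 1 by (field; exact Ht).
    apply pow1. }
  transitivity ((2 / t) ^ m * (t / 2) ^ m * ((-1) ^ j * (INR (fact m) /
    (INR (fact j) * INR (fact (m + j)))) * ((t / 2) ^ 2) ^ j)); [|rewrite h; ring].
  unfold Rdiv; ring.
Qed.

(** The [m]-th term of [E_{1/n}], written with the power series in [(k|x|/2)^2]
    so that the origin needs no separate treatment. *)
Definition wave_term (n : nat) (s k : R) (omega x : C) (m : nat) : C :=
  (RtoC (/ Gamma (INR m / INR n + 1) * (s / 2) ^ m
         * Bessel_series m ((k * Cmod x / 2) ^ 2)) * (Cconj omega * x) ^ m)%C.

Lemma Gamma_index_pos n m : (1 <= n)%nat -> 0 < Gamma (INR m / INR n + 1).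
Proof.
intros Hn; apply Gamma_pos.
assert (0 < INR n) by (apply lt_0_INR; lia).
assert (0 <= INR m / INR n) by (apply Rdiv_le_0_compat; [apply pos_INR|assumption]).
lra.
Qed.

(** Rotating [x] by [omega] is multiplication by [conj omega]. *)
Lemma rotated_coordinate omega x :
  (RtoC (dot x omega) + Ci * RtoC (dot x (perp omega)))%C = (Cconj omega * x)%C.
Proof.
destruct x, omega; unfold dot, perp; apply C_ext; unfold Re, Im; simpl; ring.
Qed.

Lemma Cmod_rotated omega x : Cmod omega = 1 ->
  Cmod (dot x omega, dot x (perp omega)) = Cmod x.
Proof.
intros Ho.
replace ((dot x omega, dot x (perp omega)) : C) with (Cconj omega * x)%C.
- rewrite Cmod_mult, Cmod_conj, Ho, Rmult_1_l; reflexivity.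
- rewrite <- rotated_coordinate; apply C_ext; unfold Re, Im; simpl; ring.
Qed.

Lemma E_inv_eq_series n x s k omega : (1 <= n)%nat -> Cmod omega = 1 ->
  E_inv n x s k omega = CSeries (wave_term n s k omega x).
Proof.
intros Hn Ho; unfold E_inv, E_alpha; cbn [fst snd].
rewrite Cmod_rotated by exact Ho.
assert (E : forall m,
  ((RtoC (s / 2) * (RtoC (dot x omega) + Ci * RtoC (dot x (perp omega)))) ^ m
     / RtoC (Gamma (/ INR n * INR m + 1))
     * RtoC (BesselJ_normalized m (k * Cmod x)))%C = wave_term n s k omega x m).
{ intros m; rewrite rotated_coordinate, BesselJ_normalized_eq; unfold wave_term.
  replace (/ INR n * INR m) with (INR m / INR n) by (unfold Rdiv; ring).
  assert (HG := Gamma_index_pos n m Hn).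
  rewrite Cpow_mult_l, !RtoC_mult, RtoC_inv, RtoC_pow by lra.
  unfold Cdiv; ring. }
unfold CSeries; f_equal; apply Series_ext; intros m; rewrite E; reflexivity.
Qed.

(** In the [m]-th coefficient [Gamma (m + 1) = m!] cancels the factorial in the
    divided power, and [ik] cancels up to the factor [1/2]. *)
Lemma Herglotz_g_N n N s k omega x : 0 < k ->
  Herglotz k (g_N n N s k omega) x = sum_n (wave_term n s k omega x) (n * N).
Proof.
intros Hk; unfold Herglotz, circle_int.
apply (is_RInt_unique (V := C_R_CompleteNormedModule)).
set (coef := fun m => (RtoC (/ (2 * PI)) * (RtoC (Gamma (INR m + 1) / Gamma (INR m / INR n + 1))
   * (RtoC s * Cconj omega / (Ci * RtoC k)) ^ m))%C).
assert (Hpi := PI_RGT_0).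
assert (Hterm : forall m, wave_term n s k omega x m =
   (coef m * (RtoC (2 * PI) * divpow (Ci * k * x / 2) m *
     RtoC (Bessel_series m ((k * Cmod x / 2) ^ 2))))%C).
{ intros m; unfold wave_term, coef, divpow; rewrite Gamma_fact.
  assert (h := INR_fact_pos m).
  transitivity ((RtoC (/ (2 * PI)) * RtoC (2 * PI)) *
    (RtoC (INR (fact m)) * RtoC (/ INR (fact m))) *
    RtoC (/ Gamma (INR m / INR n + 1)) * RtoC (Bessel_series m ((k * Cmod x / 2) ^ 2)) *
    ((RtoC s * Cconj omega / (Ci * RtoC k)) * (Ci * k * x / 2)) ^ m)%C.
  2:{ rewrite Cpow_mult_l; unfold Rdiv; rewrite !(RtoC_mult (INR (fact m))); ring. }
  rewrite <- !RtoC_mult, !Rinv_l, Rinv_r by lra.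
  replace ((RtoC s * Cconj omega / (Ci * RtoC k)) * (Ci * k * x / 2))%C
    with (RtoC (s / 2) * (Cconj omega * x))%C.
  - rewrite (Cpow_mult_l (RtoC (s / 2))), <- RtoC_pow, !RtoC_mult; ring.
  - unfold Rdiv; rewrite RtoC_mult, RtoC_inv by lra.
    field; repeat split; try (apply RtoC_neq_0; lra).
    intros E; apply (f_equal Im) in E; simpl in E; lra. }
rewrite (sum_n_ext _ _ _ Hterm).
apply is_RInt_ext with (fun t => @sum_n C_AbelianMonoid (fun m =>
   coef m * (cis (k * dot x (cis t)) * cis t ^ m))%C (n * N)).
{ intros t _; C_eq; unfold g_N; change (cos t, sin t) with (cis t).
  rewrite !Cmult_sum_n; apply sum_n_ext; intros m; C_eq; unfold coef.
  replace (RtoC s * Cconj omega * cis t / (Ci * RtoC k))%C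
    with ((RtoC s * Cconj omega / (Ci * RtoC k)) * cis t)%C by (unfold Cdiv; ring).
  rewrite Cpow_mult_l; ring. }
apply is_RInt_sum_n; intros m.
apply is_RInt_Cmult, Jacobi_Anger.
Qed.

(** * Termwise bounds *)

Lemma pow_diff_bound (z w : C) (X : R) m : Cmod z <= X -> Cmod w <= X ->
  Cmod (z ^ S m - w ^ S m) <= INR (S m) * X ^ m * Cmod (z - w).
Proof.
intros Hz Hw; induction m as [|m IH].
- simpl; rewrite !Cmult_1_r; lra.
- rewrite (Cpow_S z), (Cpow_S w).
  replace (z * z ^ S m - w * w ^ S m)%C
    with (z * (z ^ S m - w ^ S m) + w ^ S m * (z - w))%C by ring.
  apply Rle_trans with (1 := Cmod_triangle _ _); rewrite !Cmod_mult, Cmod_pow.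
  rewrite S_INR.
  assert (h1 : Cmod w ^ S m <= X ^ S m) by (apply pow_incr; split; [apply Cmod_ge_0|exact Hw]).
  assert (h2 := Cmod_ge_0 z); assert (h3 := Cmod_ge_0 (z - w)).
  assert (h4 := Cmod_ge_0 (z ^ S m - w ^ S m)).
  assert (h5 : Cmod z * Cmod (z ^ S m - w ^ S m) <= X * (INR (S m) * X ^ m * Cmod (z - w)))
    by (apply Rmult_le_compat; assumption).
  assert (h6 : Cmod w ^ S m * Cmod (z - w) <= X ^ S m * Cmod (z - w))
    by (apply Rmult_le_compat_r; assumption).
  replace (X * (INR (S m) * X ^ m * Cmod (z - w)))
    with (INR (S m) * (X ^ S m * Cmod (z - w))) in h5 by (simpl pow; ring).
  lra.
Qed.

Lemma Series_le_majorant (a b : nat -> R) :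
  (forall j, Rabs (a j) <= b j) -> ex_series b -> Rabs (Series a) <= Series b.
Proof.
intros Hab Hb.
assert (Ha : ex_series (fun j => Rabs (a j))).
{ apply (ex_series_le (V := R_CompleteNormedModule)) with b; [|exact Hb].
  intros j; unfold norm; simpl; unfold abs; simpl; rewrite Rabs_Rabsolu; apply Hab. }
apply Rle_trans with (1 := Series_Rabs _ Ha), Series_le; [|exact Hb].
intros j; split; [apply Rabs_pos|apply Hab].
Qed.

Lemma Bessel_series_bound m v : 0 <= v -> Rabs (Bessel_series m v) <= exp v.
Proof.
intros Hv; rewrite <- (is_series_unique _ _ (is_series_exp v)).
apply Series_le_majorant; [|eexists; apply is_series_exp].
intros j; rewrite Rabs_mult, (Rabs_pos_eq (v ^ j)) by (apply pow_le; exact Hv).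
apply Rmult_le_compat_r; [apply pow_le; exact Hv|apply bessel_coef_bound].
Qed.

(** By [|v^j - w^j| <= j V^{j-1} |v - w|] the differences are dominated by the
    exponential series at [V], shifted by one index. *)
Lemma Bessel_series_lipschitz m v w V : 0 <= v <= V -> 0 <= w <= V ->
  Rabs (Bessel_series m v - Bessel_series m w) <= exp V * Rabs (v - w).
Proof.
intros Hv Hw; unfold Bessel_series, PSeries.
rewrite <- Series_minus by apply ex_Bessel_series.
set (b := fun j => match j with O => 0 | S i => Rabs (v - w) * (/ INR (fact i) * V ^ i) end).
assert (Hb : is_series b (exp V * Rabs (v - w))).
{ apply (is_series_decr_1 (V := R_NormedModule)); unfold b at 2.
  apply (is_series_ext (fun i => scal (Rabs (v - w)) (/ INR (fact i) * V ^ i))); [reflexivity|].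
  refine (eq_ind _ (fun y => is_series _ y)
    (is_series_scal_l (V := R_NormedModule) (Rabs (v - w)) _ _ (is_series_exp V)) _ _).
  unfold plus, opp, scal; simpl; unfold mult; simpl; ring. }
rewrite <- (is_series_unique _ _ Hb); apply Series_le_majorant; [|eexists; exact Hb].
intros [|i].
- simpl; rewrite Rminus_eq_0, Rabs_R0; apply Rle_refl.
- rewrite <- Rmult_minus_distr_l, Rabs_mult.
  assert (H := pow_diff_bound (RtoC v) (RtoC w) V i).
  rewrite <- !RtoC_pow, <- !RtoC_minus, !Cmod_R in H.
  rewrite (Rabs_pos_eq v), (Rabs_pos_eq w) in H by lra.
  specialize (H ltac:(lra) ltac:(lra)).
  assert (h := bessel_coef_bound m (S i)).
  assert (hf := INR_fact_pos i).
  apply Rle_trans with (/ INR (fact (S i)) * (INR (S i) * V ^ i * Rabs (v - w))).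
  + apply Rmult_le_compat; try apply Rabs_pos; assumption.
  + right; unfold b; rewrite fact_simpl, mult_INR; field.
    split; [lra|apply not_0_INR; lia].
Qed.

(** With [p = sX/2], the common size of the [m]-th term and of its Lipschitz
    constant on the disk of radius [X]; the factor [m + 1] comes from the latter. *)
Definition wave_majorant (n : nat) (p : R) (m : nat) : R :=
  / Gamma (INR m / INR n + 1) * (INR m + 1) * p ^ m.

(** The three summands account for the Lipschitz bound of the Bessel factor, for
    that of the power of [x], and for the plain bound of the term. *)
Definition wave_const (k X : R) : R :=
  exp ((k * X / 2) ^ 2) * (k ^ 2 * X / 2 + / X + 1).

Lemma Bessel_arg_bound k X (x : C) : 0 < k -> Cmod x <= X ->
  0 <= (k * Cmod x / 2) ^ 2 <= (k * X / 2) ^ 2.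
Proof.
intros Hk Hx; assert (h := Cmod_ge_0 x); split; [apply pow2_ge_0|].
apply pow_incr; nra.
Qed.

Lemma exp_le_compat a b : a <= b -> exp a <= exp b.
Proof.
intros [h|h]; [left; apply exp_increasing; exact h|right; rewrite h; reflexivity].
Qed.

Lemma wave_const_pos k X : 0 < k -> 0 < X -> 0 < wave_const k X.
Proof.
intros Hk HX; apply Rmult_lt_0_compat; [apply exp_pos|].
assert (0 < / X) by (apply Rinv_0_lt_compat; exact HX).
assert (0 < k ^ 2 * X) by (apply Rmult_lt_0_compat; [apply pow_lt|]; assumption).
lra.
Qed.

Lemma wave_const_le k X0 X X1 : 0 < k -> 0 < X0 <= X -> X <= X1 ->
  wave_const k X <= exp ((k * X1 / 2) ^ 2) * (k ^ 2 * X1 / 2 + / X0 + 1).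
Proof.
intros Hk HX0 HX1; unfold wave_const.
assert (hk : 0 < k ^ 2) by (apply pow_lt; exact Hk).
assert (h1 : exp ((k * X / 2) ^ 2) <= exp ((k * X1 / 2) ^ 2))
  by (apply exp_le_compat, pow_incr; nra).
assert (h2 : 0 < / X) by (apply Rinv_0_lt_compat; lra).
assert (h3 : / X <= / X0) by (apply Rinv_le_contravar; lra).
assert (h4 : k ^ 2 * X <= k ^ 2 * X1) by (apply Rmult_le_compat_l; lra).
assert (h5 : 0 < k ^ 2 * X) by (apply Rmult_lt_0_compat; lra).
apply Rmult_le_compat; [apply Rlt_le, exp_pos|lra|exact h1|lra].
Qed.

Lemma Cmod_wave_power omega (x : C) (s X : R) m : Cmod omega = 1 -> 0 < s -> Cmod x <= X ->
  (s / 2) ^ m * Cmod ((Cconj omega * x) ^ m) <= (s * X / 2) ^ m.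
Proof.
intros Ho Hs Hx; rewrite Cmod_pow, Cmod_mult, Cmod_conj, Ho, <- Rpow_mult_distr.
assert (h := Cmod_ge_0 x); apply pow_incr; nra.
Qed.

Lemma Cmod_sub_le (x y : C) : Rabs (Cmod x - Cmod y) <= Cmod (x - y).
Proof.
assert (h1 := Cmod_triangle (x - y) y); assert (h2 := Cmod_triangle (y - x) x).
replace (x - y + y)%C with x in h1 by ring; replace (y - x + x)%C with y in h2 by ring.
replace (y - x)%C with (- (x - y))%C in h2 by ring; rewrite Cmod_opp in h2.
apply Rabs_le; lra.
Qed.

Lemma wave_term_bound n s k omega x X m :
  (1 <= n)%nat -> 0 < s -> 0 < k -> Cmod omega = 1 -> 0 < X -> Cmod x <= X ->
  Cmod (wave_term n s k omega x m) <= wave_const k X * wave_majorant n (s * X / 2) m.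
Proof.
intros Hn Hs Hk Ho HX Hx; unfold wave_term, wave_majorant, wave_const.
assert (Hc : 0 < / Gamma (INR m / INR n + 1))
  by (apply Rinv_0_lt_compat, Gamma_index_pos; exact Hn).
set (c := / Gamma (INR m / INR n + 1)) in *.
destruct (Bessel_arg_bound k X x Hk Hx) as [Hv0 HvX].
assert (hB := Bessel_series_bound m _ Hv0).
assert (hP := Cmod_wave_power omega x s X m Ho Hs Hx).
assert (hm := pos_INR m).
assert (hs : 0 < (s / 2) ^ m) by (apply pow_lt; lra).
rewrite Cmod_mult, Cmod_R, !Rabs_mult, (Rabs_pos_eq c), (Rabs_pos_eq ((s / 2) ^ m)) by lra.
set (B := Rabs (Bessel_series m ((k * Cmod x / 2) ^ 2))) in *.
set (Z := Cmod ((Cconj omega * x) ^ m)) in *.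
set (V := exp ((k * X / 2) ^ 2)).
assert (hV : B <= V) by (apply Rle_trans with (1 := hB), exp_le_compat, HvX).
assert (hB0 : 0 <= B) by apply Rabs_pos.
assert (hZ0 : 0 <= (s / 2) ^ m * Z) by (apply Rmult_le_pos; [lra|apply Cmod_ge_0]).
assert (h1 : B * ((s / 2) ^ m * Z) <= V * (s * X / 2) ^ m)
  by (apply Rmult_le_compat; assumption).
assert (hX : 0 < / X) by (apply Rinv_0_lt_compat; exact HX).
assert (hk : 0 < k ^ 2 * X) by (apply Rmult_lt_0_compat; [apply pow_lt|]; assumption).
assert (h2 : 1 <= (k ^ 2 * X / 2 + / X + 1) * (INR m + 1)).
{ rewrite <- (Rmult_1_l 1); apply Rmult_le_compat; lra. }
assert (h3 : 0 <= V * (s * X / 2) ^ m)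
  by (apply Rmult_le_pos; [apply Rlt_le, exp_pos|apply pow_le; nra]).
apply Rle_trans with (c * (V * (s * X / 2) ^ m)).
- replace (c * (s / 2) ^ m * B * Z) with (c * (B * ((s / 2) ^ m * Z))) by ring.
  apply Rmult_le_compat_l; lra.
- replace (V * (k ^ 2 * X / 2 + / X + 1) * (c * (INR m + 1) * (s * X / 2) ^ m))
    with (c * ((V * (s * X / 2) ^ m) * ((k ^ 2 * X / 2 + / X + 1) * (INR m + 1)))) by ring.
  apply Rmult_le_compat_l; [lra|].
  rewrite <- (Rmult_1_r (V * _)) at 1; apply Rmult_le_compat_l; assumption.
Qed.

(** The difference of products is split into
    [(Bx - By) zx^m + By (zx^m - zy^m)]; the power costs [m X^{m-1}], that is
    [m/X] relative to [X^m]. *)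
Lemma wave_term_lipschitz n s k omega x y X m :
  (1 <= n)%nat -> 0 < s -> 0 < k -> Cmod omega = 1 -> 0 < X ->
  Cmod x <= X -> Cmod y <= X ->
  Cmod (wave_term n s k omega x m - wave_term n s k omega y m)
    <= wave_const k X * wave_majorant n (s * X / 2) m * Cmod (x - y).
Proof.
intros Hn Hs Hk Ho HX Hx Hy; unfold wave_term, wave_majorant, wave_const.
assert (Hc : 0 < / Gamma (INR m / INR n + 1))
  by (apply Rinv_0_lt_compat, Gamma_index_pos; exact Hn).
set (c := / Gamma (INR m / INR n + 1)) in *.
destruct (Bessel_arg_bound k X x Hk Hx) as [Hv0 HvX].
destruct (Bessel_arg_bound k X y Hk Hy) as [Hw0 HwX].
assert (hB := Bessel_series_bound m _ Hw0).
assert (hL := Bessel_series_lipschitz m _ _ _ (conj Hv0 HvX) (conj Hw0 HwX)).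
assert (hP := Cmod_wave_power omega x s X m Ho Hs Hx).
assert (hm := pos_INR m).
assert (hs : 0 < (s / 2) ^ m) by (apply pow_lt; lra).
set (Bx := Bessel_series m ((k * Cmod x / 2) ^ 2)) in *.
set (By := Bessel_series m ((k * Cmod y / 2) ^ 2)) in *.
set (V := exp ((k * X / 2) ^ 2)) in *.
set (zx := (Cconj omega * x)%C) in *; set (zy := (Cconj omega * y)%C) in *.
set (d := Cmod (x - y)).
assert (hd : 0 <= d) by apply Cmod_ge_0.
assert (hV0 : 0 < V) by apply exp_pos.
assert (hV : Rabs By <= V) by (apply Rle_trans with (1 := hB), exp_le_compat, HwX).
assert (hX : 0 < / X) by (apply Rinv_0_lt_compat; exact HX).
assert (hpow : 0 < (s * X / 2) ^ m) by (apply pow_lt; nra).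
assert (hv : Rabs ((k * Cmod x / 2) ^ 2 - (k * Cmod y / 2) ^ 2) <= k ^ 2 * X / 2 * d).
{ replace ((k * Cmod x / 2) ^ 2 - (k * Cmod y / 2) ^ 2)
    with (k ^ 2 / 4 * (Cmod x + Cmod y) * (Cmod x - Cmod y)) by field.
  assert (h := Cmod_ge_0 x); assert (h' := Cmod_ge_0 y).
  assert (hk : 0 < k ^ 2) by (apply pow_lt; exact Hk).
  rewrite Rabs_mult, Rabs_pos_eq by nra.
  apply Rmult_le_compat; [nra|apply Rabs_pos|nra|apply Cmod_sub_le]. }
assert (hzd : Cmod (zx - zy) = d).
{ unfold zx, zy, d; replace (Cconj omega * x - Cconj omega * y)%C
    with (Cconj omega * (x - y))%C by ring.
  rewrite Cmod_mult, Cmod_conj, Ho; ring. }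
assert (hdiff : (s / 2) ^ m * Cmod (zx ^ m - zy ^ m) <= INR m * / X * (s * X / 2) ^ m * d).
{ destruct m as [|m'].
  - simpl; replace (1 - 1)%C with (RtoC 0) by ring; rewrite Cmod_0; lra.
  - assert (H : Cmod (zx ^ S m' - zy ^ S m') <= INR (S m') * X ^ m' * d).
    { rewrite <- hzd; apply pow_diff_bound; unfold zx, zy;
        rewrite Cmod_mult, Cmod_conj, Ho; lra. }
    apply Rle_trans with ((s / 2) ^ S m' * (INR (S m') * X ^ m' * d)).
    + apply Rmult_le_compat_l; [lra|exact H].
    + right; replace (s * X / 2) with (s / 2 * X) by field.
      rewrite Rpow_mult_distr; simpl pow; field; lra. }
replace (RtoC (c * (s / 2) ^ m * Bx) * zx ^ m - RtoC (c * (s / 2) ^ m * By) * zy ^ m)%C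
  with (RtoC c * (RtoC (Bx - By) * (RtoC ((s / 2) ^ m) * zx ^ m)
        + RtoC By * (RtoC ((s / 2) ^ m) * (zx ^ m - zy ^ m))))%C
  by (rewrite !RtoC_mult, RtoC_minus; ring).
rewrite Cmod_mult, Cmod_R, (Rabs_pos_eq c) by lra.
apply Rle_trans with (c * ((V * (k ^ 2 * X / 2 * d)) * (s * X / 2) ^ m
                           + V * (INR m * / X * (s * X / 2) ^ m * d))).
- apply Rmult_le_compat_l; [lra|].
  apply Rle_trans with (1 := Cmod_triangle _ _).
  rewrite !Cmod_mult, !Cmod_R, !(Rabs_pos_eq ((s / 2) ^ m)) by lra.
  apply Rplus_le_compat.
  + apply Rmult_le_compat; [apply Rabs_pos| | |exact hP].
    * apply Rmult_le_pos; [lra|apply Cmod_ge_0].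
    * apply Rle_trans with (1 := hL), Rmult_le_compat_l; [lra|exact hv].
  + apply Rmult_le_compat; [apply Rabs_pos| |exact hV|exact hdiff].
    apply Rmult_le_pos; [lra|apply Cmod_ge_0].
- replace (V * (k ^ 2 * X / 2 + / X + 1) * (c * (INR m + 1) * (s * X / 2) ^ m) * d)
    with (c * ((V * (s * X / 2) ^ m * d) * ((k ^ 2 * X / 2 + / X + 1) * (INR m + 1)))) by ring.
  replace (V * (k ^ 2 * X / 2 * d) * (s * X / 2) ^ m + V * (INR m * / X * (s * X / 2) ^ m * d))
    with ((V * (s * X / 2) ^ m * d) * (k ^ 2 * X / 2 + INR m * / X)) by ring.
  apply Rmult_le_compat_l; [lra|]; apply Rmult_le_compat_l.
  + repeat apply Rmult_le_pos; lra.
  + assert (hk : 0 < k ^ 2 * X) by (apply Rmult_lt_0_compat; [apply pow_lt|]; assumption).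
    assert (hm0 : 0 <= INR m * (k ^ 2 * X / 2)) by (apply Rmult_le_pos; lra).
    lra.
Qed.

(** * Remainders of series *)

Lemma series_tail (a : nat -> R) P : ex_series a ->
  sum_n a P - Series a = - Series (fun l => a (S P + l)%nat).
Proof.
intros Ha; rewrite (Series_incr_n a (S P)) by (auto with arith).
rewrite sum_n_Reals; simpl pred; ring.
Qed.

Lemma ex_series_Re_Im (T : nat -> C) (b : nat -> R) P :
  (forall l, Cmod (T (S P + l)%nat) <= b l) -> ex_series b ->
  ex_series (fun m => Re (T m)) /\ ex_series (fun m => Im (T m)).
Proof.
intros Hb Hex; split; apply (ex_series_incr_n _ (S P));
  apply (ex_series_le (V := R_CompleteNormedModule)) with b; try exact Hex;
  intros l; apply Rle_trans with (2 := Hb l); [apply re_le_Cmod|apply im_le_Cmod].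
Qed.

Lemma Cmod_le_Re_Im (z : C) : Cmod z <= Rabs (Re z) + Rabs (Im z).
Proof.
replace z with (RtoC (Re z) + Ci * RtoC (Im z))%C at 1
  by (apply C_ext; unfold Re, Im; simpl; ring).
apply Rle_trans with (1 := Cmod_triangle _ _).
rewrite Cmod_mult, Cmod_Ci, !Cmod_R; lra.
Qed.

(** Bounding the real and imaginary parts separately costs the factor 2. *)
Lemma CSeries_remainder_bound (T : nat -> C) (b : nat -> R) P :
  (forall l, Cmod (T (S P + l)%nat) <= b l) -> ex_series b ->
  Cmod (sum_n T P - CSeries T) <= 2 * Series b.
Proof.
intros Hb Hex; destruct (ex_series_Re_Im T b P Hb Hex) as [HRe HIm].
apply Rle_trans with (1 := Cmod_le_Re_Im _).
replace (Re (sum_n T P - CSeries T)) with (sum_n (fun m => Re (T m)) P - Series (fun m => Re (T m)))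
  by (rewrite <- Re_sum_n; reflexivity).
replace (Im (sum_n T P - CSeries T)) with (sum_n (fun m => Im (T m)) P - Series (fun m => Im (T m)))
  by (rewrite <- Im_sum_n; reflexivity).
rewrite !series_tail, !Rabs_Ropp by assumption.
assert (h1 : Rabs (Series (fun l => Re (T (S P + l)%nat))) <= Series b).
{ apply Series_le_majorant; [|exact Hex]; intros l;
    apply Rle_trans with (2 := Hb l), re_le_Cmod. }
assert (h2 : Rabs (Series (fun l => Im (T (S P + l)%nat))) <= Series b).
{ apply Series_le_majorant; [|exact Hex]; intros l;
    apply Rle_trans with (2 := Hb l), im_le_Cmod. }
lra.
Qed.

Lemma sum_n_Cminus (T U : nat -> C) P :
  sum_n (fun m => T m - U m)%C P = (sum_n T P - sum_n U P)%C.
Proof.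
induction P as [|P IH]; [rewrite !sum_O; reflexivity|].
rewrite !sum_Sn, IH; unfold plus; simpl; ring.
Qed.

Lemma CSeries_remainder_lipschitz (T U : nat -> C) (b : nat -> R) (L : R) P :
  (forall l, Cmod (T (S P + l)%nat) <= b l) -> (forall l, Cmod (U (S P + l)%nat) <= b l) ->
  (forall l, Cmod (T (S P + l)%nat - U (S P + l)%nat) <= b l * L) -> ex_series b ->
  Cmod ((sum_n T P - CSeries T) - (sum_n U P - CSeries U)) <= 2 * (Series b * L).
Proof.
intros HT HU HTU Hex.
destruct (ex_series_Re_Im T b P HT Hex) as [HTr HTi].
destruct (ex_series_Re_Im U b P HU Hex) as [HUr HUi].
rewrite <- Series_scal_r.
replace ((sum_n T P - CSeries T) - (sum_n U P - CSeries U))%C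
  with (sum_n (fun m => T m - U m)%C P - CSeries (fun m => T m - U m)%C)%C.
- apply CSeries_remainder_bound; [exact HTU|]; apply ex_series_scal_r, Hex.
- rewrite sum_n_Cminus.
  transitivity ((sum_n T P - sum_n U P) - (CSeries T - CSeries U))%C; [|ring].
  f_equal; unfold CSeries; apply C_ext.
  + exact (Series_minus _ _ HTr HUr).
  + exact (Series_minus _ _ HTi HUi).
Qed.

(** * Geometric decay beyond the cut-off *)

Lemma finite_upper_bound (f : nat -> R) n :
  exists K, 0 < K /\ forall i, (i < n)%nat -> f i <= K.
Proof.
induction n as [|n [K [HK IH]]]; [exists 1; split; [lra|lia]|].
exists (Rmax K (f n)); split; [apply Rlt_le_trans with (1 := HK), Rmax_l|].
intros i Hi; destruct (PeanoNat.Nat.eq_dec i n) as [->|Hn]; [apply Rmax_r|].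
apply Rle_trans with K; [apply IH; lia|apply Rmax_l].
Qed.

(** Each application of the functional equation multiplies by [M + 1 + z], which
    is at least [M + 1]. *)
Lemma Gamma_add_nat_ge z M : 0 <= z ->
  INR (fact M) * Gamma (z + 1) <= Gamma (INR M + z + 1).
Proof.
intros Hz; induction M as [|M IH].
- simpl; rewrite Rplus_0_l; lra.
- assert (hM := pos_INR M).
  assert (hG : 0 < Gamma (z + 1)) by (apply Gamma_pos; lra).
  replace (INR (S M) + z + 1) with ((INR M + z + 1) + 1) by (rewrite S_INR; ring).
  rewrite (Gamma_succ (INR M + z + 1)) by lra.
  rewrite fact_simpl, mult_INR, S_INR, Rmult_assoc.
  apply Rmult_le_compat; try lra.
  apply Rmult_le_pos; [apply Rlt_le, INR_fact_pos|lra].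
Qed.

(** Only the [n] fractional parts [i/n] occur, so one constant serves them all. *)
Lemma inv_Gamma_bound n : (1 <= n)%nat -> exists K, 0 < K /\
  forall M i, (i < n)%nat ->
    / Gamma (INR (n * M + i) / INR n + 1) <= K / INR (fact M).
Proof.
intros Hn; assert (hn : 0 < INR n) by (apply lt_0_INR; lia).
destruct (finite_upper_bound (fun i => / Gamma (INR i / INR n + 1)) n) as [K [HK Hi]].
exists K; split; [exact HK|]; intros M i Hlt.
replace (INR (n * M + i) / INR n) with (INR M + INR i / INR n)
  by (rewrite plus_INR, mult_INR; field; lra).
assert (hz : 0 <= INR i / INR n) by (apply Rdiv_le_0_compat; [apply pos_INR|exact hn]).
assert (h := Gamma_add_nat_ge (INR i / INR n) M hz).
assert (hf := INR_fact_pos M).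
assert (hG : 0 < Gamma (INR i / INR n + 1)) by (apply Gamma_pos; lra).
apply Rle_trans with (/ (INR (fact M) * Gamma (INR i / INR n + 1))).
- apply Rinv_le_contravar; [apply Rmult_lt_0_compat; assumption|exact h].
- rewrite Rinv_mult, Rmult_comm; apply Rmult_le_compat_r; [|apply Hi, Hlt].
  apply Rlt_le, Rinv_0_lt_compat; exact hf.
Qed.

Lemma pow_over_fact_decay a N d : 0 <= a -> (1 <= N)%nat -> a <= INR N / 2 ->
  a ^ (N + d) / INR (fact (N + d)) <= a ^ N / INR (fact N) * (/ 2) ^ d.
Proof.
intros Ha HN Ha2; induction d as [|d IH].
- rewrite PeanoNat.Nat.add_0_r; simpl; lra.
- replace (N + S d)%nat with (S (N + d)) by lia.
  assert (h0 : 0 < INR (S (N + d))) by (apply lt_0_INR; lia).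
  assert (h1 := INR_fact_pos (N + d)).
  rewrite fact_simpl, mult_INR.
  replace (a ^ S (N + d) / (INR (S (N + d)) * INR (fact (N + d))))
    with ((a ^ (N + d) / INR (fact (N + d))) * (a / INR (S (N + d))))
    by (simpl pow; field; lra).
  replace (a ^ N / INR (fact N) * (/ 2) ^ S d)
    with ((a ^ N / INR (fact N) * (/ 2) ^ d) * / 2) by (simpl pow; ring).
  apply Rmult_le_compat; [| |exact IH|].
  + apply Rdiv_le_0_compat; [apply pow_le; exact Ha|exact h1].
  + apply Rdiv_le_0_compat; assumption.
  + apply Rmult_le_reg_r with (INR (S (N + d))); [exact h0|].
    unfold Rdiv; rewrite Rmult_assoc, Rinv_l, Rmult_1_r by lra.
    assert (INR N <= INR (S (N + d))) by (apply le_INR; lia); lra.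
Qed.

(** A number whose [n]-th power is at least [1/2] ([half_le_block_ratio_pow]). It
    turns a halving per block of [n] terms into a geometric decay per term. *)
Definition block_ratio (n : nat) : R := 1 - / (2 * INR n).

Lemma block_ratio_bounds n : (1 <= n)%nat -> 0 < block_ratio n < 1.
Proof.
intros Hn; unfold block_ratio.
assert (1 <= INR n) by (apply (le_INR 1); exact Hn).
assert (0 < / (2 * INR n)) by (apply Rinv_0_lt_compat; lra).
assert (/ (2 * INR n) <= / 2) by (apply Rinv_le_contravar; lra).
lra.
Qed.

Lemma Bernoulli_inequality h n : 0 <= h <= 1 -> 1 - INR n * h <= (1 - h) ^ n.
Proof.
intros Hh; induction n as [|n IH]; [simpl; lra|].
rewrite S_INR; simpl pow; assert (hn := pos_INR n).
assert (0 <= INR n * h ^ 2) by (apply Rmult_le_pos; [exact hn|apply pow2_ge_0]).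
apply Rle_trans with ((1 - h) * (1 - INR n * h)); [nra|].
apply Rmult_le_compat_l; lra.
Qed.

Lemma half_le_block_ratio_pow n : (1 <= n)%nat -> / 2 <= block_ratio n ^ n.
Proof.
intros Hn; assert (hn : 1 <= INR n) by (apply (le_INR 1); exact Hn).
assert (h := block_ratio_bounds n Hn); unfold block_ratio in *.
apply Rle_trans with (2 := Bernoulli_inequality (/ (2 * INR n)) n ltac:(lra)).
right; field; lra.
Qed.

Lemma pow_antitone q i j : 0 <= q <= 1 -> (i <= j)%nat -> q ^ j <= q ^ i.
Proof.
intros Hq Hij; replace j with (i + (j - i))%nat by lia; rewrite pow_add.
assert (0 <= q ^ i) by (apply pow_le; lra).
assert (q ^ (j - i) <= 1) by (rewrite <- (pow1 (j - i)); apply pow_incr; lra).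
rewrite <- (Rmult_1_r (q ^ i)) at 2; apply Rmult_le_compat_l; assumption.
Qed.

Lemma pow_le_1_plus p i n : 0 <= p -> (i <= n)%nat -> p ^ i <= 1 + p ^ n.
Proof.
intros Hp Hi; destruct (Rle_lt_dec p 1) as [H|H].
- assert (p ^ i <= 1) by (rewrite <- (pow1 i); apply pow_incr; lra).
  assert (0 <= p ^ n) by (apply pow_le; exact Hp); lra.
- assert (p ^ i <= p ^ n) by (apply Rle_pow; [lra|exact Hi]); lra.
Qed.

(** One factor [N] comes from the weight [m + 1 = O(N (l + 1))], the other from the incomplete block: [p^i] with [i < n] is at most
    [1 + p^n = O(N)]. *)
Lemma majorant_tail_bound n : (1 <= n)%nat -> exists K, 0 < K /\
  forall N p l, (1 <= N)%nat -> 0 < p -> p ^ n <= INR N / 2 ->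
    wave_majorant n p (S (n * N) + l) <=
      K * INR N ^ 2 * ((p ^ n) ^ N / INR (fact N)) * (INR (S l) * block_ratio n ^ l).
Proof.
intros Hn; destruct (inv_Gamma_bound n Hn) as [K0 [HK0 HG]].
assert (hn : 1 <= INR n) by (apply (le_INR 1); exact Hn).
(* The 12 is [2 * 3 * 2]: from the halving bound, from [m + 1 <= 3 n N (l + 1)]
   and from [1 + a <= 2 N]. *)
exists (12 * K0 * INR n); split; [nra|].
intros N p l HN Hp HpN.
assert (hN : 1 <= INR N) by (apply (le_INR 1); exact HN).
set (m := (S (n * N) + l)%nat).
set (M := (m / n)%nat); set (i := (m mod n)%nat).
assert (Hm : (m = n * M + i)%nat) by (apply PeanoNat.Nat.div_mod; lia).
assert (Hi : (i < n)%nat) by (apply PeanoNat.Nat.mod_upper_bound; lia).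
assert (HM : (N <= M)%nat) by (apply PeanoNat.Nat.div_le_lower_bound; unfold m; lia).
set (a := p ^ n) in *.
assert (ha : 0 < a) by (apply pow_lt; exact Hp).
assert (hq := block_ratio_bounds n Hn); set (q := block_ratio n) in *.
set (F := a ^ N / INR (fact N)).
assert (hF : 0 < F) by (apply Rdiv_lt_0_compat; [apply pow_lt; exact ha|apply INR_fact_pos]).
assert (hdecay : a ^ M / INR (fact M) <= F * (/ 2) ^ (M - N)).
{ replace M with (N + (M - N))%nat at 1 2 by lia.
  apply pow_over_fact_decay; [lra|exact HN|exact HpN]. }
assert (hhalf : (/ 2) ^ (M - N) <= 2 * q ^ l).
(* The factor 2 pays for the position of the index inside its block: with [m] at
   most [n - 1] beyond [nM], [l < n (M - N + 1)]. *)
{ replace ((/ 2) ^ (M - N)) with (2 * (/ 2) ^ S (M - N)) by (simpl pow; field).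
  apply Rmult_le_compat_l; [lra|].
  apply Rle_trans with (q ^ (n * S (M - N))).
  - rewrite pow_mult; apply pow_incr; split; [lra|apply half_le_block_ratio_pow, Hn].
  - apply pow_antitone; [lra|].
    replace (n * S (M - N))%nat with (n * M - n * N + n)%nat by nia.
    unfold m in Hm; nia. }
assert (hql : 0 < q ^ l) by (apply pow_lt; lra).
unfold wave_majorant.
replace (p ^ m) with (a ^ M * p ^ i)
  by (unfold a; rewrite <- pow_mult, <- pow_add, <- Hm; reflexivity).
assert (hpi := pow_le_1_plus p i n ltac:(lra) ltac:(lia)); fold a in hpi.
assert (hc := HG M i Hi); rewrite <- Hm in hc.
assert (hc0 : 0 < / Gamma (INR m / INR n + 1))
  by (apply Rinv_0_lt_compat, Gamma_index_pos, Hn).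
set (c := / Gamma (INR m / INR n + 1)) in *.
assert (hl := pos_INR l).
assert (hm : INR m + 1 <= 3 * (INR n * INR N) * INR (S l)).
{ unfold m; rewrite plus_INR, !S_INR, mult_INR.
  assert (1 <= INR n * INR N) by nra; nra. }
assert (hm0 : 0 <= INR m) by apply pos_INR.
assert (haM : 0 < a ^ M) by (apply pow_lt; exact ha).
assert (hpi0 : 0 < p ^ i) by (apply pow_lt; exact Hp).
assert (hfM := INR_fact_pos M).
assert (step1 : c * a ^ M <= K0 * (F * (2 * q ^ l))).
{ apply Rle_trans with (K0 * (a ^ M / INR (fact M))).
  - replace (K0 * (a ^ M / INR (fact M))) with (K0 / INR (fact M) * a ^ M) by (field; lra).
    apply Rmult_le_compat_r; [lra|exact hc].
  - apply Rmult_le_compat_l; [lra|].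
    apply Rle_trans with (1 := hdecay), Rmult_le_compat_l; [lra|exact hhalf]. }
assert (step2 : (INR m + 1) * p ^ i <= 3 * (INR n * INR N) * INR (S l) * (2 * INR N)).
{ apply Rmult_le_compat; lra. }
replace (c * (INR m + 1) * (a ^ M * p ^ i)) with ((c * a ^ M) * ((INR m + 1) * p ^ i)) by ring.
apply Rle_trans with (K0 * (F * (2 * q ^ l)) * (3 * (INR n * INR N) * INR (S l) * (2 * INR N))).
- apply Rmult_le_compat; [| |exact step1|exact step2]; apply Rmult_le_pos; lra.
- right; ring.
Qed.

Lemma ex_series_succ_geom q : 0 < q < 1 -> ex_series (fun l => INR (S l) * q ^ l).
Proof.
intros Hq.
assert (hpos : forall l, 0 < INR (S l) * q ^ l).
{ intros l; apply Rmult_lt_0_compat; [apply lt_0_INR; lia|apply pow_lt; lra]. }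
apply ex_series_ext with (fun l => Rabs (INR (S l) * q ^ l)).
{ intros l; apply Rabs_pos_eq, Rlt_le, hpos. }
apply ex_series_DAlembert with q; [lra|intros l; apply Rgt_not_eq, hpos|].
apply is_lim_seq_ext with (fun l => q + q * / INR (S l)).
{ intros l; assert (h : 0 < INR (S l)) by (apply lt_0_INR; lia).
  assert (hl : 0 < q ^ l) by (apply pow_lt; lra).
  rewrite Rabs_pos_eq by (apply Rlt_le, Rdiv_lt_0_compat; apply hpos).
  rewrite (S_INR (S l)); simpl pow; field; lra. }
replace (Finite q) with (Finite (q + q * 0)) by (f_equal; ring).
apply is_lim_seq_plus'; [apply is_lim_seq_const|].
apply (is_lim_seq_scal_l _ q 0).
replace (Finite 0) with (Rbar_inv p_infty) by reflexivity.
apply is_lim_seq_inv; [|discriminate].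
apply (is_lim_seq_incr_1 INR), is_lim_seq_INR.
Qed.

(** * Sizes as the number of blocks grows *)

Lemma pow_le_fact_exp N x : 0 <= x -> x ^ N / INR (fact N) <= exp x.
Proof.
intros Hx; apply Rle_trans with (2 := exp_ge_taylor x N Hx).
assert (h : forall k, 0 <= x ^ k / INR (fact k)).
{ intros k; apply Rdiv_le_0_compat; [apply pow_le; exact Hx|apply INR_fact_pos]. }
destruct N as [|N]; [simpl; lra|].
rewrite tech5; assert (0 <= sum_f_R0 (fun k => x ^ k / INR (fact k)) N)
  by (apply cond_pos_sum; exact h); lra.
Qed.

Lemma exp_pow x N : exp x ^ N = exp (INR N * x).
Proof.
induction N as [|N IH]; [simpl; rewrite Rmult_0_l, exp_0; reflexivity|].
rewrite S_INR; simpl pow; rewrite IH, <- exp_plus; f_equal; ring.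
Qed.

(** With [a <= (g N / e) (1 + h)], [h = C e / (g N)], the factor [(1 + h)^N] is
    bounded by [e^{Nh}], and [N^N / N! <= e^N] is one term of the exponential
    series. *)
Lemma leading_term_bound g C N a : 0 < g -> 0 <= C -> (1 <= N)%nat ->
  0 <= a <= g / exp 1 * INR N + C ->
  a ^ N / INR (fact N) <= exp (INR N * ln g) * exp (C * exp 1 / g).
Proof.
intros Hg HC HN Ha; assert (he := exp_pos 1).
assert (hN : 0 < INR N) by (apply lt_0_INR; lia).
assert (hf := INR_fact_pos N).
set (h := C * exp 1 / g / INR N).
assert (hh : 0 <= h).
{ unfold h; repeat apply Rdiv_le_0_compat; try assumption; nra. }
assert (E : g / exp 1 * INR N + C = INR N * (g * (exp (Ropp 1)) * (1 + h))).
{ rewrite exp_Ropp; unfold h; field; lra. }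
rewrite E in Ha.
assert (h1 : a ^ N <= (INR N * (g * exp (Ropp 1) * (1 + h))) ^ N) by (apply pow_incr; exact Ha).
rewrite !Rpow_mult_distr, (exp_pow (Ropp 1)) in h1.
assert (h2 : (1 + h) ^ N <= exp (C * exp 1 / g)).
{ apply Rle_trans with (exp h ^ N).
  - apply pow_incr; split; [lra|apply exp_ineq1_le].
  - rewrite exp_pow; right; f_equal; unfold h; field; lra. }
assert (h3 : INR N ^ N / INR (fact N) <= exp (INR N)) by (apply pow_le_fact_exp; lra).
assert (h4 : g ^ N = exp (INR N * ln g)) by (rewrite <- exp_pow, exp_ln by exact Hg; reflexivity).
rewrite h4 in h1.
assert (h5 : exp (INR N) * exp (INR N * Ropp 1) = 1).
{ rewrite <- exp_plus; replace (INR N + INR N * Ropp 1) with 0 by ring; apply exp_0. }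
set (u := exp (INR N * ln g)) in *; set (v := exp (INR N * Ropp 1)) in *.
assert (hu : 0 < u) by apply exp_pos; assert (hv : 0 < v) by apply exp_pos.
assert (hw : 0 <= (1 + h) ^ N) by (apply pow_le; lra).
apply Rle_trans with ((INR N ^ N / INR (fact N)) * v * (u * (1 + h) ^ N)).
- unfold Rdiv; replace (INR N ^ N * / INR (fact N) * v * (u * (1 + h) ^ N))
    with ((INR N ^ N * (u * v * (1 + h) ^ N)) * / INR (fact N)) by ring.
  apply Rmult_le_compat_r; [apply Rlt_le, Rinv_0_lt_compat; exact hf|exact h1].
- apply Rle_trans with ((exp (INR N) * v) * (u * exp (C * exp 1 / g)));
    [|rewrite h5; lra].
  apply Rmult_le_compat.
  + apply Rmult_le_pos; [apply Rdiv_le_0_compat; [apply pow_le; lra|exact hf]|lra].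
  + apply Rmult_le_pos; lra.
  + apply Rmult_le_compat_r; [lra|exact h3].
  + apply Rmult_le_compat_l; lra.
Qed.

(** The relative change of [(rs)^n], which is of order [N], is of order [1/N]. *)
Lemma perturbed_power_bound r s g C n N : 0 < r -> 0 < s -> 0 < g -> 0 <= C -> (1 <= N)%nat ->
  Rabs ((r * s) ^ n - g * INR N) <= C ->
  (s * (2 * r * (1 + / INR N)) / 2) ^ n <= g * INR N + (C + 3 ^ n * (g + C)).
Proof.
intros Hr Hs Hg HC HN Habs.
assert (hN : 1 <= INR N) by (apply (le_INR 1); exact HN).
assert (hi : 0 < / INR N) by (apply Rinv_0_lt_compat; lra).
assert (hi1 : / INR N <= 1) by (rewrite <- Rinv_1; apply Rinv_le_contravar; lra).
replace (s * (2 * r * (1 + / INR N)) / 2) with ((r * s) * (1 + / INR N)) by (field; lra).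
rewrite Rpow_mult_distr.
assert (hp : (1 + / INR N) ^ n <= 1 + 3 ^ n * / INR N).
{ clear - hi hi1; set (h := / INR N) in *; induction n as [|n IH]; [simpl; lra|]; simpl pow.
  assert (h1 : 1 <= 3 ^ n) by (apply pow_R1_Rle; lra).
  assert (h2 : (1 + h) * (1 + h) ^ n <= (1 + h) * (1 + 3 ^ n * h))
    by (apply Rmult_le_compat_l; lra).
  assert (h3 : 1 * h <= 3 ^ n * h) by (apply Rmult_le_compat_r; lra).
  assert (h4 : (3 ^ n * h) * h <= (3 ^ n * h) * 1) by (apply Rmult_le_compat_l; lra).
  lra. }
apply Rabs_le_between in Habs.
assert (h3 : 1 <= 3 ^ n) by (apply pow_R1_Rle; lra).
apply Rle_trans with ((g * INR N + C) * (1 + 3 ^ n * / INR N)).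
- apply Rmult_le_compat; [apply pow_le; nra|apply pow_le; lra|lra|exact hp].
- replace ((g * INR N + C) * (1 + 3 ^ n * / INR N))
    with (g * INR N + (C + 3 ^ n * (g + C * / INR N))) by (field; lra).
  assert (C * / INR N <= C) by nra.
  assert (3 ^ n * (g + C * / INR N) <= 3 ^ n * (g + C)) by (apply Rmult_le_compat_l; lra).
  lra.
Qed.

(** Monotonicity of [ln t + t/e] gives the second inequality, and the first
    follows since [g/e] is positive. *)
Lemma gamma_bounds g0 g : gamma0_eq g0 -> 0 < g < g0 -> g < 1 /\ g / exp 1 + ln g < 0.
Proof.
intros [H0 E0] Hg; assert (he := exp_pos 1).
assert (hl : ln g < ln g0) by (apply ln_increasing; lra).
assert (hd : g / exp 1 < g0 / exp 1)
  by (apply Rmult_lt_compat_r; [apply Rinv_0_lt_compat; exact he|lra]).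
assert (hp : 0 < g / exp 1) by (apply Rdiv_lt_0_compat; lra).
split; [|lra].
apply ln_lt_inv; [lra|lra|rewrite ln_1; lra].
Qed.

(** Half a power of [N] is absorbed by the exponential factor of the bound. *)
Lemma square_le_three_halves N c : (1 <= N)%nat -> 0 < c ->
  INR N ^ 2 <= / c * (Rpower (INR N) (3 / 2) * exp (INR N * c)).
Proof.
intros HN Hc; assert (hN : 1 <= INR N) by (apply (le_INR 1); exact HN).
assert (E : INR N ^ 2 = Rpower (INR N) (3 / 2) * Rpower (INR N) (1 / 2)).
{ rewrite <- Rpower_plus, <- Rpower_pow by lra; f_equal; simpl; field. }
assert (h1 : Rpower (INR N) (1 / 2) <= INR N).
{ rewrite <- (Rpower_1 (INR N)) at 2 by lra; apply Rle_Rpower; lra. }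
assert (h2 : INR N <= / c * exp (INR N * c)).
{ apply Rmult_le_reg_l with c; [exact Hc|].
  rewrite <- Rmult_assoc, Rinv_r, Rmult_1_l by lra.
  assert (h := exp_ineq1_le (INR N * c)); lra. }
assert (h0 : 0 < Rpower (INR N) (3 / 2)) by apply exp_pos.
rewrite E; replace (/ c * (Rpower (INR N) (3 / 2) * exp (INR N * c)))
  with (Rpower (INR N) (3 / 2) * (/ c * exp (INR N * c))) by ring.
apply Rmult_le_compat_l; lra.
Qed.

Lemma exp_decay_beats_power c m N : 0 < c -> (1 <= N)%nat ->
  Rpower (INR N) (3 / 2) * exp (INR N * - c) <=
    INR (fact (m + 2)) / c ^ (m + 2) * / INR N ^ m.
Proof.
intros Hc HN; assert (hN : 1 <= INR N) by (apply (le_INR 1); exact HN).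
assert (hf := INR_fact_pos (m + 2)).
assert (h1 : Rpower (INR N) (3 / 2) <= INR N ^ 2).
{ rewrite <- Rpower_pow by lra; apply Rle_Rpower; [lra|simpl; lra]. }
assert (h2 := pow_le_fact_exp (m + 2) (INR N * c) ltac:(nra)).
rewrite Rpow_mult_distr in h2.
assert (hcm : 0 < c ^ (m + 2)) by (apply pow_lt; exact Hc).
assert (hNm : 0 < INR N ^ m) by (apply pow_lt; lra).
assert (he := exp_pos (INR N * c)).
replace (INR N * - c) with (- (INR N * c)) by ring; rewrite exp_Ropp.
apply Rle_trans with (INR N ^ 2 * / exp (INR N * c)).
- apply Rmult_le_compat_r; [apply Rlt_le, Rinv_0_lt_compat; exact he|exact h1].
- apply Rmult_le_reg_r with (exp (INR N * c)); [exact he|].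
  rewrite Rmult_assoc, Rinv_l, Rmult_1_r by lra.
  replace (INR N ^ 2) with (INR (fact (m + 2)) / c ^ (m + 2) * / INR N ^ m *
    (INR N ^ (m + 2) * c ^ (m + 2) / INR (fact (m + 2)))).
  + apply Rmult_le_compat_l; [|exact h2].
    apply Rmult_le_pos; [apply Rdiv_le_0_compat; lra|apply Rlt_le, Rinv_0_lt_compat, hNm].
  + rewrite (pow_add (INR N)).
    set (cm := c ^ (m + 2)) in *; set (Nm := INR N ^ m) in *; field; lra.
Qed.

(** * From Lipschitz bounds to gradients and suprema *)

(** [Derive] is the limit of the difference quotients along [h = 1/(i+1)], so it
    inherits any bound that they satisfy near [h = 0]. *)
Lemma Derive_abs_le (f : R -> R) x L d : 0 < d ->
  (forall h, Rabs h < d -> Rabs (f (x + h) - f x) <= L * Rabs h) ->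
  Rabs (Derive f x) <= L.
Proof.
intros Hd Hlip; unfold Derive, Lim.
set (u := fun i : nat => (f (x + Rbar_loc_seq 0 i) - f x) / Rbar_loc_seq 0 i).
change (Rabs (Lim_seq u) <= L).
assert (Hu : eventually (fun i => Rabs (u i) <= L)).
{ destruct (nfloor_ex (/ d)) as [i0 [_ Hi0]]; [apply Rlt_le, Rinv_0_lt_compat, Hd|].
  exists i0; intros i Hi; unfold u; cbn [Rbar_loc_seq].
  apply le_INR in Hi; rewrite Rplus_0_l.
  assert (hd := Rinv_0_lt_compat d Hd).
  assert (hi : 0 < / (INR i + 1)) by (apply Rinv_0_lt_compat; lra).
  assert (hlt : / (INR i + 1) < d).
  { rewrite <- (Rinv_inv d); apply Rinv_0_lt_contravar; lra. }
  assert (h := Hlip (/ (INR i + 1)) ltac:(rewrite Rabs_pos_eq; lra)).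
  unfold Rdiv; rewrite Rabs_mult, Rinv_inv, (Rabs_pos_eq (INR i + 1)) by lra.
  rewrite (Rabs_pos_eq (/ _)) in h by lra.
  apply Rmult_le_reg_r with (/ (INR i + 1)); [exact hi|].
  rewrite Rmult_assoc, Rinv_r, Rmult_1_r by lra; exact h. }
assert (H1 : Rbar_le (- L) (Lim_seq u)).
{ rewrite <- (Lim_seq_const (- L)); apply Lim_seq_le_loc.
  revert Hu; apply filter_imp; intros i h; apply Rabs_le_between in h; lra. }
assert (H2 : Rbar_le (Lim_seq u) L).
{ rewrite <- (Lim_seq_const L); apply Lim_seq_le_loc.
  revert Hu; apply filter_imp; intros i h; apply Rabs_le_between in h; lra. }
destruct (Lim_seq u); simpl in *; [|contradiction|contradiction].
apply Rabs_le; lra.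
Qed.

(** Each of the four real partial derivatives is at most [L] in absolute value. *)
Lemma grad_norm_le (f : C -> C) (x : C) X L : 0 <= L -> Cmod x < X ->
  (forall y, Cmod y <= X -> Cmod (f y - f x) <= L * Cmod (y - x)) ->
  grad_norm f x <= 2 * L.
Proof.
intros HL Hx Hlip.
assert (Hline : forall (v : C) h, Cmod v = 1 -> Rabs h < X - Cmod x ->
   Cmod (f (x + RtoC h * v)%C - f x) <= L * Rabs h).
{ intros v h Hv Hh; assert (E : Cmod (RtoC h * v) = Rabs h)
    by (rewrite Cmod_mult, Hv, Cmod_R; ring).
  rewrite <- E; replace (RtoC h * v)%C with ((x + RtoC h * v) - x)%C at 2 by ring.
  apply Hlip, Rle_trans with (1 := Cmod_triangle _ _); rewrite E; lra. }
assert (E1 : forall h, (fst x + h, snd x) = (x + RtoC h * RtoC 1)%C)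
  by (intros h; apply C_ext; unfold Re, Im; simpl; ring).
assert (E2 : forall h, (fst x, snd x + h) = (x + RtoC h * Ci)%C)
  by (intros h; apply C_ext; unfold Re, Im; simpl; ring).
assert (H1 := fun h => Hline 1%C h Cmod_1); assert (H2 := fun h => Hline Ci h Cmod_Ci).
assert (Hx' : forall t, (fst t, snd t) = t :> C) by (intros [? ?]; reflexivity).
assert (B1r : Rabs (Re (partial1 f x)) <= L).
{ apply (Derive_abs_le _ _ _ (X - Cmod x)); [lra|]; intros h Hh; rewrite E1, Hx'.
  apply Rle_trans with (2 := H1 h Hh).
  exact (re_le_Cmod (f (x + RtoC h * RtoC 1)%C - f x)). }
assert (B1i : Rabs (Im (partial1 f x)) <= L).
{ apply (Derive_abs_le _ _ _ (X - Cmod x)); [lra|]; intros h Hh; rewrite E1, Hx'.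
  apply Rle_trans with (2 := H1 h Hh).
  exact (im_le_Cmod (f (x + RtoC h * RtoC 1)%C - f x)). }
assert (B2r : Rabs (Re (partial2 f x)) <= L).
{ apply (Derive_abs_le _ _ _ (X - Cmod x)); [lra|]; intros h Hh; rewrite E2, Hx'.
  apply Rle_trans with (2 := H2 h Hh).
  exact (re_le_Cmod (f (x + RtoC h * Ci)%C - f x)). }
assert (B2i : Rabs (Im (partial2 f x)) <= L).
{ apply (Derive_abs_le _ _ _ (X - Cmod x)); [lra|]; intros h Hh; rewrite E2, Hx'.
  apply Rle_trans with (2 := H2 h Hh).
  exact (im_le_Cmod (f (x + RtoC h * Ci)%C - f x)). }
assert (Hsq : forall y, Rabs y <= L -> y ^ 2 <= L ^ 2).
{ intros y Hy; rewrite <- (pow2_abs y); apply pow_incr; split; [apply Rabs_pos|exact Hy]. }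
unfold grad_norm; rewrite !Cmod2_alt.
rewrite <- (sqrt_pow2 (2 * L)) by lra; apply sqrt_le_1_alt.
generalize (Hsq _ B1r), (Hsq _ B1i), (Hsq _ B2r), (Hsq _ B2i); lra.
Qed.

Lemma sup_disk_bounds rho (u : C -> R) M : 0 <= rho -> (forall x, 0 <= u x) ->
  (forall x, Cmod x <= rho -> u x <= M) ->
  Rbar_le 0 (sup_disk rho u) /\ Rbar_le (sup_disk rho u) M.
Proof.
intros Hrho H0 HM; unfold sup_disk.
destruct (Lub_Rbar_correct (fun y => exists x, Cmod x <= rho /\ y = u x)) as [Hub Hlub].
split.
- apply Rbar_le_trans with (u 0%C); [apply H0|].
  apply Hub; exists 0%C; split; [rewrite Cmod_0; exact Hrho|reflexivity].
- apply Hlub; intros y [x [Hx ->]]; apply HM, Hx.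
Qed.

Lemma Rbar_abs_plus_le (a b : Rbar) (A B : R) :
  Rbar_le 0 a /\ Rbar_le a A -> Rbar_le 0 b /\ Rbar_le b B ->
  Rbar_le (Rbar_abs (Rbar_plus a b)) (A + B).
Proof.
destruct a, b; simpl; intros [h1 h2] [h3 h4]; try contradiction.
rewrite Rabs_pos_eq; lra.
Qed.

(** * The main estimate *)

Definition herglotz_error (n N : nat) (s k : R) (omega x : C) : C :=
  (Herglotz k (g_N n N s k omega) x - E_inv n x s k omega)%C.

(** The error is minus a remainder whose terms are, by [majorant_tail_bound],
    multiples of the fixed convergent series of [(l + 1) q^l], where
    [q = block_ratio n]. *)
Lemma herglotz_error_bounds n : (1 <= n)%nat -> exists K, 0 < K /\
  forall N s k omega X, (1 <= N)%nat -> 0 < s -> 0 < k -> Cmod omega = 1 -> 0 < X ->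
    (s * X / 2) ^ n <= INR N / 2 ->
    let L := K * wave_const k X * (INR N ^ 2 * (((s * X / 2) ^ n) ^ N / INR (fact N))) in
    (forall x, Cmod x <= X -> Cmod (herglotz_error n N s k omega x) <= L) /\
    (forall x y, Cmod x <= X -> Cmod y <= X ->
       Cmod (herglotz_error n N s k omega x - herglotz_error n N s k omega y)
         <= L * Cmod (x - y)).
Proof.
intros Hn; destruct (majorant_tail_bound n Hn) as [K [HK Htail]].
assert (hW := ex_series_succ_geom _ (block_ratio_bounds n Hn)).
set (w := fun l => INR (S l) * block_ratio n ^ l) in *.
assert (hw0 : forall l, 0 < w l).
{ intros l; apply Rmult_lt_0_compat; [apply lt_0_INR; lia|].
  apply pow_lt, block_ratio_bounds, Hn. }
assert (HW : 0 < Series w).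
{ rewrite (Series_incr_1 w hW).
  assert (0 <= Series (fun l => w (S l))); [|generalize (hw0 O); lra].
  rewrite <- (is_series_unique _ _ is_series_zero) at 1.
  apply Series_le; [|apply (ex_series_incr_1 w), hW].
  intros l; split; [lra|apply Rlt_le, hw0]. }
exists (2 * K * Series w); split; [repeat apply Rmult_lt_0_compat; lra|].
intros N s k omega X HN Hs Hk Ho HX Hp L.
set (Q := K * INR N ^ 2 * (((s * X / 2) ^ n) ^ N / INR (fact N))) in *.
set (b := fun l => wave_const k X * Q * w l).
assert (hsX : 0 < s * X / 2) by nra.
assert (hA := Rlt_le _ _ (wave_const_pos k X Hk HX)).
assert (hmaj : forall l, wave_const k X * wave_majorant n (s * X / 2) (S (n * N) + l) <= b l).
{ intros l; unfold b; rewrite Rmult_assoc; apply Rmult_le_compat_l; [exact hA|].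
  apply Htail; assumption. }
assert (hb : ex_series b) by (apply (ex_series_scal_l (V := R_NormedModule)), hW).
assert (hL : L = 2 * Series b)
  by (unfold b; rewrite Series_scal_l; unfold L, Q; ring).
assert (hterm : forall x, Cmod x <= X -> forall l,
   Cmod (wave_term n s k omega x (S (n * N) + l)) <= b l).
{ intros x Hx l; apply Rle_trans with (2 := hmaj l); apply wave_term_bound; assumption. }
assert (herr : forall x, herglotz_error n N s k omega x =
   (sum_n (wave_term n s k omega x) (n * N) - CSeries (wave_term n s k omega x))%C).
{ intros x; unfold herglotz_error; rewrite Herglotz_g_N, E_inv_eq_series by assumption.
  reflexivity. }
split.
- intros x Hx; rewrite herr, hL; apply CSeries_remainder_bound; [apply hterm, Hx|exact hb].
- intros x y Hx Hy; rewrite !herr, hL, Rmult_assoc.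
  apply CSeries_remainder_lipschitz; [apply hterm, Hx|apply hterm, Hy| |exact hb].
  intros l; apply Rle_trans with
    (wave_const k X * wave_majorant n (s * X / 2) (S (n * N) + l) * Cmod (x - y)).
  + apply wave_term_lipschitz; assumption.
  + apply Rmult_le_compat_r; [apply Cmod_ge_0|apply hmaj].
Qed.

Theorem theorem3p1 :
  forall (k r : R) (omega : C) (n : nat) (gamma0 gamma : R) (s : nat -> R),
    0 < k -> 0 < r -> Cmod omega = 1 -> (1 <= n)%nat ->
    gamma0_eq gamma0 -> 0 < gamma < gamma0 ->
    (forall N : nat, (1 <= N)%nat -> 0 < s N) ->
    is_bigO (fun N => Finite ((r * s N) ^ n - gamma / exp 1 * INR N))
            (fun _ => 1) ->
    let D (N : nat) (x : C) : C :=
      (Herglotz k (g_N n N (s N) k omega) x - E_inv n x (s N) k omega)%C in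
    let B (N : nat) : R :=
      Rpower (INR N) (3 / 2) * exp (INR N * (gamma / exp 1 + ln gamma)) in
    is_bigO (fun N => Rbar_plus (sup_disk (2 * r) (fun x => Cmod (D N x)))
                                (sup_disk (2 * r) (grad_norm (D N))))
            B
    /\ is_bigO_infty (fun N => Finite (B N)).
Proof.
intros k r omega n gamma0 gamma s Hk Hr Ho Hn H0 Hg Hs [C0 HC0] D B.
destruct (gamma_bounds gamma0 gamma H0 Hg) as [Hg1 Hneg].
assert (he := exp_pos 1).
assert (hge : 0 < gamma / exp 1) by (apply Rdiv_lt_0_compat; lra).
assert (HBpos : forall N, 0 < B N) by (intros N; apply Rmult_lt_0_compat; apply exp_pos).
split.
- destruct (herglotz_error_bounds n Hn) as [K [HK Herr]].
  set (C1 := Rabs C0).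
  assert (HC1 : 0 <= C1) by apply Rabs_pos.
  set (C2 := C1 + 3 ^ n * (gamma / exp 1 + C1)).
  assert (HC2 : 0 <= C2).
  { assert (0 <= 3 ^ n * (gamma / exp 1 + C1)) by (apply Rmult_le_pos; [apply pow_le|]; lra).
    unfold C2; lra. }
  set (A := exp ((k * (4 * r) / 2) ^ 2) * (k ^ 2 * (4 * r) / 2 + / (2 * r) + 1)).
  set (E := exp (C2 * exp 1 / gamma)).
  (* One [L] for the error and two for its gradient, where [L] is the common bound
     of the error and of its Lipschitz constant. *)
  exists (3 * (K * A * (/ (gamma / exp 1) * E))).
  (* Here [gamma < 1] and [2 < e] leave room between [gamma / e] and [1/2]. *)
  assert (Hlarge : eventually (fun N => (1 <= N)%nat /\
            gamma / exp 1 * INR N + C2 <= INR N / 2)).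
  { assert (hslack : 0 < / 2 - gamma / exp 1).
    { assert (2 < exp 1) by (generalize (exp_ineq1 1 ltac:(lra)); lra).
      assert (/ exp 1 < / 2) by (apply Rinv_0_lt_contravar; lra).
      assert (0 < / exp 1) by (apply Rinv_0_lt_compat; lra).
      unfold Rdiv; nra. }
    destruct (nfloor_ex (C2 / (/ 2 - gamma / exp 1))) as [N0 [_ HN0]].
    { apply Rdiv_le_0_compat; assumption. }
    exists (S N0); intros N HN; split; [lia|].
    apply le_INR in HN; rewrite S_INR in HN.
    assert (h : C2 / (/ 2 - gamma / exp 1) * (/ 2 - gamma / exp 1)
                <= INR N * (/ 2 - gamma / exp 1)) by (apply Rmult_le_compat_r; lra).
    unfold Rdiv at 1 in h; rewrite Rmult_assoc, Rinv_l, Rmult_1_r in h by lra.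
    lra. }
  generalize (filter_and _ _ HC0 Hlarge); apply filter_imp.
  intros N [Hrs [HN Hhalf]].
  assert (hN : 1 <= INR N) by (apply (le_INR 1); exact HN).
  assert (hiN : 0 < / INR N <= 1).
  { split; [apply Rinv_0_lt_compat; lra|].
    rewrite <- Rinv_1; apply Rinv_le_contravar; lra. }
  specialize (Hs N HN); simpl in Hrs; rewrite Rabs_R1, Rmult_1_r in Hrs.
  assert (Hrs' : Rabs ((r * s N) ^ n - gamma / exp 1 * INR N) <= C1)
    by (apply Rle_trans with (1 := Hrs), Rle_abs).
  set (X := 2 * r * (1 + / INR N)).
  assert (HX0 : 2 * r < X) by (unfold X; nra).
  assert (HX1 : X <= 4 * r) by (unfold X; nra).
  assert (Hpert := perturbed_power_bound r (s N) (gamma / exp 1) C1 n N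
                     Hr Hs hge HC1 HN Hrs').
  fold X C2 in Hpert.
  set (a := (s N * X / 2) ^ n) in *.
  assert (ha : 0 < a) by (apply pow_lt; nra).
  destruct (Herr N (s N) k omega X HN Hs Hk Ho ltac:(lra) ltac:(fold a; lra)) as [Hsup Hlip].
  fold a in Hsup, Hlip.
  set (L := K * wave_const k X * (INR N ^ 2 * (a ^ N / INR (fact N)))) in *.
  assert (HL0 : 0 <= L).
  { apply Rle_trans with (2 := Hsup 0%C ltac:(rewrite Cmod_0; lra)), Cmod_ge_0. }
  assert (HL : L <= K * A * (/ (gamma / exp 1) * E) * B N).
  { assert (hlead := leading_term_bound gamma C2 N a ltac:(lra) HC2 HN ltac:(lra)).
    fold E in hlead.
    assert (hsq := square_le_three_halves N (gamma / exp 1) HN hge).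
    assert (hwave := wave_const_le k (2 * r) X (4 * r) Hk ltac:(lra) HX1); fold A in hwave.
    assert (hF : 0 <= a ^ N / INR (fact N))
      by (apply Rdiv_le_0_compat; [apply pow_le; lra|apply INR_fact_pos]).
    assert (hA := wave_const_pos k X Hk ltac:(lra)).
    assert (h1 : INR N ^ 2 * (a ^ N / INR (fact N)) <= / (gamma / exp 1) * E * B N).
    { unfold B; rewrite Rmult_plus_distr_l, exp_plus.
      replace (/ (gamma / exp 1) * E * (Rpower (INR N) (3 / 2) *
          (exp (INR N * (gamma / exp 1)) * exp (INR N * ln gamma))))
        with ((/ (gamma / exp 1) * (Rpower (INR N) (3 / 2) * exp (INR N * (gamma / exp 1))))
              * (exp (INR N * ln gamma) * E)) by ring.
      apply Rmult_le_compat; [apply pow2_ge_0|exact hF|exact hsq|exact hlead]. }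
    unfold L; rewrite Rmult_assoc, (Rmult_assoc K A), (Rmult_assoc K (A * _)).
    apply Rmult_le_compat_l; [lra|]; rewrite (Rmult_assoc A).
    apply Rmult_le_compat; [lra| |exact hwave|exact h1].
    apply Rmult_le_pos; [apply pow2_ge_0|exact hF]. }
  rewrite (Rabs_pos_eq (B N)) by (apply Rlt_le, HBpos).
  apply Rbar_le_trans with (Finite (L + 2 * L)).
  + apply Rbar_abs_plus_le; apply sup_disk_bounds; try lra.
    * intros x; apply Cmod_ge_0.
    * intros x Hx; apply (Hsup x); lra.
    * intros x; apply sqrt_pos.
    * intros x Hx; apply grad_norm_le with X; [exact HL0|lra|].
      intros y Hy; apply (Hlip y x); lra.
  + simpl; lra.
- intros m _; set (c := - (gamma / exp 1 + ln gamma)).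
  exists (INR (fact (m + 2)) / c ^ (m + 2)); exists 1%nat; intros N HN.
  assert (hNm : 0 < / INR N ^ m)
    by (apply Rinv_0_lt_compat, pow_lt, lt_0_INR; lia).
  rewrite (Rabs_pos_eq (/ _)) by lra.
  cbn [Rbar_abs Rbar_le]; rewrite Rabs_pos_eq by (apply Rlt_le, HBpos).
  unfold B; replace (gamma / exp 1 + ln gamma) with (- c) by (unfold c; ring).
  apply exp_decay_beats_power; [unfold c; lra|exact HN].
Qed.
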